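(* Let $R$ be a commutative noetherian ring, and let $M_R$ be a finitely generated $R$-module. Then $V(M)\sqcup B(M)=V^*(M)$.
   Context: $V(M)$ is the monoid of isomorphism classes $[N]$ of modules $N$ isomorphic to direct summands of finite direct sums of copies of $M$; $V^*(M)$ is the monoid of isomorphism classes of countably generated direct summands of arbitrary direct sums of copies of $M$; addition is induced by direct sum. For a ring $S$, $V(S)$ and $V^*(S)$ are the monoids of isomorphism classes of finitely, respectively countably, generated projective right $S$-modules. Let $S=\mathrm{End}_R(M)$. The trace of a projective right $S$-module $P$ is $\sum_{f\in\mathrm{Hom}_S(P,S)}f(P)$; $\mathcal{T}(S)$ is the set of ideals of $S$ that are traces of countably generated projective right $S$-modules. A countably generated projective right $S$-module $P$ is $I$-big if every countably generated projective right $S$-module $Q$ with $QI=Q$ is a homomorphic image of $P$. For $I\in\mathcal{T}(S)$ and a finitely generated projective right $S/I$-module $P'$, there is, up to isomorphism, a unique countably generated projective $I$-big right $S$-module $P$ with $P/PI\cong P'$; let $\iota_I\colon V(S/I)\to V^*(S)$, $[P']\mapsto[P]$. Let $\alpha_I\colon V(S/I)\to V^*(M)$ be the composition of $\iota_I$ with the monoid isomorphism $V^*(S)\to V^*(M)$, $[P]\mapsto[P\otimes_S M]$. Then $B(M)=\bigcup_{I\in\mathcal{T}(S)\setminus\{0\}}\alpha_I(V(S/I))\subseteq V^*(M)\setminus V(M)$, and $V(M)\sqcup B(M)$ denotes the (disjoint) union. *)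

(* Defs.v *)
From HB Require Import structures.
From mathcomp Require Import all_boot all_order all_algebra.
From mathcomp Require Import all_classical.

Set Implicit Arguments.
Unset Strict Implicit.
Unset Printing Implicit Defensive.

Import GRing.Theory.

Local Open Scope classical_set_scope.
Local Open Scope quotient_scope.
Local Open Scope ring_scope.

(* Rings are [pzRingType]s, so that the zero ring is allowed: S / I is zero
   when I = S.  A right S-module is an [lmodType S^c], where S^c is the opposite
   ring: p s is written [(s : S^c) *: p].  Over a commutative R, left and
   right modules are identified. *)

Section Modules.
Variable R : pzRingType.
Implicit Types A B C P : lmodType R.

Definition isomorphic A B := exists f : {linear A -> B}, bijective f.

(* A class of modules is a plain predicate: [lmodType R] is too large a type
   for [set]. *)
Definition module_class := lmodType R -> Prop.

Definition iso_class A : module_class := fun B => isomorphic A B.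

Definition is_summand A B := exists C, isomorphic (A * C)%type B.

Definition fin_gen A := exists (n : nat) (g : 'I_n -> A),
  forall x, exists c : 'I_n -> R, x = \sum_(i < n) c i *: g i.

(* At most countably generated: g may repeat its values. *)
Definition count_gen A := exists g : nat -> A,
  forall x, exists (n : nat) (c : nat -> R), x = \sum_(i < n) c i *: g i.

Definition hom_image A B :=
  exists f : {linear A -> B}, forall y, exists x, f x = y.

Definition projective P := forall A B (f : {linear A -> B}) (g : {linear P -> B}),
  (forall y, exists x, f x = y) ->
  exists h : {linear P -> A}, forall p, f (h p) = g p.

End Modules.

Section DirectSum.
Variables (R : pzRingType) (X : Type) (V : lmodType R).

Definition finsupp : {pred (X -> V)} :=
  fun f => `[< finite_set [set x | f x <> 0] >].

Lemma finsupp_submod : submod_closed finsupp.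
Proof.
split.
  apply/asboolP; rewrite [X in finite_set X](_ : _ = set0) //.
  by apply/seteqP; split=> x //= /(_ erefl).
move=> a f g /asboolP ff /asboolP fg; apply/asboolP.
apply: (@sub_finite_set _ _ ([set x | f x <> 0] `|` [set x | g x <> 0])).
  move=> x /= fgx; have [fx0|fx0] := pselect (f x = 0); last by left.
  right=> gx0; apply: fgx.
  by rewrite [LHS](_ : _ = a *: f x + g x) // fx0 gx0 scaler0 addr0.
by rewrite finite_setU.
Qed.

HB.instance Definition _ :=
  GRing.isSubmodClosed.Build R (X -> V) finsupp finsupp_submod.

(* The direct sum of X copies of V. *)
Record dsum := DSum { dsum_fun :> X -> V; dsum_finsupp : dsum_fun \in finsupp }.

HB.instance Definition _ := [isSub for dsum_fun].
HB.instance Definition _ := [Choice of dsum by <:].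
HB.instance Definition _ := [SubChoice_isSubLmodule of dsum by <:].

Lemma finsupp_delta (a : X) (v : V) :
  (fun x => if `[< x = a >] then v else 0) \in finsupp.
Proof.
apply/asboolP; apply: (@sub_finite_set _ _ [set a]); last exact: finite_set1.
by move=> x /=; case: asboolP.
Qed.

Definition delta (a : X) (v : V) : dsum := DSum (finsupp_delta a v).

End DirectSum.

Section QuotientModule.
Variables (R : pzRingType) (V : lmodType R) (K : submodClosed V).

(* K is closed under opposites because V is a module over a ring, but [submodClosed]
   does not provide the corresponding instance. *)
Definition submod_pred : {pred V} := K.

Lemma submod_pred_zmod : zmod_closed submod_pred.
Proof.
split=> [|u v Ku Kv]; first exact: rpred0.
by rewrite -scaleN1r; apply: rpredD => //; apply: rpredZ.
Qed.

HB.instance Definition _ :=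
  GRing.isZmodClosed.Build V submod_pred submod_pred_zmod.

Definition quot_mod := Quotient.quot submod_pred.
HB.instance Definition _ := GRing.Zmodule.on quot_mod.

Definition quot_mod_pi (v : V) : quot_mod := \pi_(Quotient.quot submod_pred) v.
Definition quot_mod_repr (x : quot_mod) : V := repr (x : Quotient.quot submod_pred).

Lemma quot_mod_reprK : cancel quot_mod_repr quot_mod_pi.
Proof. by move=> x; rewrite /quot_mod_pi reprK. Qed.

Lemma quot_mod_piP u v : quot_mod_pi u = quot_mod_pi v <-> u - v \in submod_pred.
Proof. by rewrite Quotient.idealrBE; split=> /eqP. Qed.

Lemma quot_mod_piD u v : quot_mod_pi (u + v) = quot_mod_pi u + quot_mod_pi v.
Proof. exact: (raddfD (\pi_(Quotient.quot submod_pred))). Qed.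

Definition quot_mod_scale (a : R) (x : quot_mod) : quot_mod :=
  quot_mod_pi (a *: quot_mod_repr x).

Lemma quot_mod_piZ a v : quot_mod_scale a (quot_mod_pi v) = quot_mod_pi (a *: v).
Proof.
by apply/quot_mod_piP; rewrite -scalerBr rpredZ //; apply/quot_mod_piP;
  rewrite quot_mod_reprK.
Qed.

Lemma quot_mod_scalerA a b x :
  quot_mod_scale a (quot_mod_scale b x) = quot_mod_scale (a * b) x.
Proof. by rewrite -[x]quot_mod_reprK !quot_mod_piZ scalerA. Qed.

Lemma quot_mod_scale1r : left_id 1 quot_mod_scale.
Proof. by move=> x; rewrite -[x]quot_mod_reprK quot_mod_piZ scale1r. Qed.

Lemma quot_mod_scalerDr : right_distributive quot_mod_scale +%R.
Proof.
move=> a x y; rewrite -[x]quot_mod_reprK -[y]quot_mod_reprK -quot_mod_piD.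
by rewrite !quot_mod_piZ scalerDr quot_mod_piD.
Qed.

Lemma quot_mod_scalerDl x : {morph quot_mod_scale^~ x : a b / a + b}.
Proof.
by move=> a b; rewrite -[x]quot_mod_reprK !quot_mod_piZ scalerDl quot_mod_piD.
Qed.

HB.instance Definition _ := GRing.Zmodule_isLmodule.Build R quot_mod
  quot_mod_scalerA quot_mod_scale1r quot_mod_scalerDr quot_mod_scalerDl.

Lemma quot_mod_scaleE (a : R) v : a *: quot_mod_pi v = quot_mod_pi (a *: v).
Proof. exact: quot_mod_piZ. Qed.

End QuotientModule.

Section Span.
Variables (R : pzRingType) (V : lmodType R) (X : set V).

Definition span_set : {pred V} := fun v => `[< exists (n : nat) (c : 'I_n -> R)
  (x : 'I_n -> V), (forall i, X (x i)) /\ v = \sum_(i < n) c i *: x i >].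

Lemma span_set_submod : submod_closed span_set.
Proof.
split.
  apply/asboolP; exists 0%N, (fun=> 0), (fun=> 0).
  by split=> [[]|] //; rewrite big_ord0.
move=> a u v /asboolP[m [c [x [Xx ->]]]] /asboolP[n [d [y [Xy ->]]]].
apply/asboolP; exists (m + n)%N.
exists (fun i => match fintype.split i with inl j => a * c j | inr j => d j end).
exists (fun i => match fintype.split i with inl j => x j | inr j => y j end).
split; first by move=> i; case: fintype.split.
rewrite big_split_ord scaler_sumr; congr (_ + _); apply: eq_bigr => i _.
  by rewrite (unsplitK (inl _ i)) scalerA.
by rewrite (unsplitK (inr _ i)).
Qed.

HB.instance Definition _ :=
  GRing.isSubmodClosed.Build R V span_set span_set_submod.

End Span.

Section EndomorphismRing.
Variables (R : comPzRingType) (M : lmodType R).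

(* End_R(M); the product is composition, so that M is a left End_R(M)-module
   by evaluation. *)
Definition endo := {linear M -> M}.
Implicit Types f g h : endo.

HB.instance Definition _ := gen_eqMixin endo.
HB.instance Definition _ := gen_choiceMixin endo.

Lemma endoP f g : f =1 g -> f = g.
Proof.
case: f g => [f [[f1] [f2]]] [g [[g1] [g2]]] /= /funext fg.
rewrite /= in fg; subst g.
by rewrite (Prop_irrelevance f1 g1) (Prop_irrelevance f2 g2).
Qed.

Definition endo_zero : endo := \0.
Definition endo_opp f : endo := \- f.
Definition endo_add f g : endo := f \+ g.
Definition endo_one : endo := idfun.
Definition endo_mul f g : endo := f \o g.

Lemma endo_addA : associative endo_add.
Proof. by move=> f g h; apply: endoP => x /=; rewrite addrA. Qed.
Lemma endo_addC : commutative endo_add.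
Proof. by move=> f g; apply: endoP => x /=; rewrite addrC. Qed.
Lemma endo_add0 : left_id endo_zero endo_add.
Proof. by move=> f; apply: endoP => x /=; rewrite add0r. Qed.
Lemma endo_addN : left_inverse endo_zero endo_opp endo_add.
Proof. by move=> f; apply: endoP => x /=; rewrite addNr. Qed.

HB.instance Definition _ :=
  GRing.isZmodule.Build endo endo_addA endo_addC endo_add0 endo_addN.

Lemma endo_mulA : associative endo_mul.
Proof. by move=> f g h; apply: endoP. Qed.
Lemma endo_mul1 : left_id endo_one endo_mul.
Proof. by move=> f; apply: endoP. Qed.
Lemma endo_1mul : right_id endo_one endo_mul.
Proof. by move=> f; apply: endoP. Qed.
Lemma endo_mulDl : left_distributive endo_mul endo_add.
Proof. by move=> f g h; apply: endoP. Qed.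
Lemma endo_mulDr : right_distributive endo_mul endo_add.
Proof. by move=> f g h; apply: endoP => x /=; rewrite linearD. Qed.

HB.instance Definition _ := GRing.Zmodule_isPzRing.Build endo
  endo_mulA endo_mul1 endo_1mul endo_mulDl endo_mulDr.

End EndomorphismRing.

(* Two-sided ideals, not necessarily proper. *)
Record ideal (S : pzRingType) := Ideal {
  ideal_pred :> {pred S};
  ideal_zmod : zmod_closed ideal_pred;
  ideal_mull : forall s x, x \in ideal_pred -> s * x \in ideal_pred;
  ideal_mulr : forall s x, x \in ideal_pred -> x * s \in ideal_pred }.

HB.instance Definition _ (S : pzRingType) (I : ideal S) :=
  GRing.isZmodClosed.Build S (ideal_pred I) (ideal_zmod I).

Definition noetherian (R : comPzRingType) := forall I : ideal R,
  exists (n : nat) (a : 'I_n -> R), forall x,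
    x \in I <-> exists c : 'I_n -> R, x = \sum_(i < n) c i * a i.

Section QuotientRing.
Variables (S : pzRingType) (I : ideal S).

Definition quot_ring := Quotient.quot (ideal_pred I).
HB.instance Definition _ := GRing.Zmodule.on quot_ring.

Definition quot_ring_pi (s : S) : quot_ring := \pi_(Quotient.quot (ideal_pred I)) s.
Definition quot_ring_repr (x : quot_ring) : S :=
  repr (x : Quotient.quot (ideal_pred I)).

Lemma quot_ring_reprK : cancel quot_ring_repr quot_ring_pi.
Proof. by move=> x; rewrite /quot_ring_pi reprK. Qed.

Lemma quot_ring_piP s t : quot_ring_pi s = quot_ring_pi t <-> s - t \in ideal_pred I.
Proof. by rewrite Quotient.idealrBE; split=> /eqP. Qed.

Lemma quot_ring_piD s t : quot_ring_pi (s + t) = quot_ring_pi s + quot_ring_pi t.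
Proof. exact: (raddfD (\pi_(Quotient.quot (ideal_pred I)))). Qed.

Definition quot_ring_one := quot_ring_pi 1.
Definition quot_ring_mul (x y : quot_ring) : quot_ring :=
  quot_ring_pi (quot_ring_repr x * quot_ring_repr y).

Lemma quot_ring_piM s t :
  quot_ring_mul (quot_ring_pi s) (quot_ring_pi t) = quot_ring_pi (s * t).
Proof.
apply/quot_ring_piP; set s' := quot_ring_repr _; set t' := quot_ring_repr _.
have -> : s' * t' - s * t = s' * (t' - t) + (s' - s) * t.
  by rewrite mulrBr mulrBl addrA subrK.
by apply: rpredD; [apply: ideal_mull | apply: ideal_mulr];
  apply/quot_ring_piP; rewrite quot_ring_reprK.
Qed.

Lemma quot_ring_mulA : associative quot_ring_mul.
Proof.
move=> x y z; rewrite -[x]quot_ring_reprK -[y]quot_ring_reprK.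
by rewrite -[z]quot_ring_reprK !quot_ring_piM mulrA.
Qed.
Lemma quot_ring_mul1 : left_id quot_ring_one quot_ring_mul.
Proof. by move=> x; rewrite -[x]quot_ring_reprK quot_ring_piM mul1r. Qed.
Lemma quot_ring_1mul : right_id quot_ring_one quot_ring_mul.
Proof. by move=> x; rewrite -[x]quot_ring_reprK quot_ring_piM mulr1. Qed.
Lemma quot_ring_mulDl : left_distributive quot_ring_mul +%R.
Proof.
move=> x y z; rewrite -[x]quot_ring_reprK -[y]quot_ring_reprK.
by rewrite -[z]quot_ring_reprK -quot_ring_piD !quot_ring_piM mulrDl quot_ring_piD.
Qed.
Lemma quot_ring_mulDr : right_distributive quot_ring_mul +%R.
Proof.
move=> x y z; rewrite -[x]quot_ring_reprK -[y]quot_ring_reprK.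
by rewrite -[z]quot_ring_reprK -quot_ring_piD !quot_ring_piM mulrDr quot_ring_piD.
Qed.

HB.instance Definition _ := GRing.Zmodule_isPzRing.Build quot_ring
  quot_ring_mulA quot_ring_mul1 quot_ring_1mul quot_ring_mulDl quot_ring_mulDr.

End QuotientRing.

Section RightModules.
Variable S : pzRingType.
Implicit Types (P Q : lmodType S^c) (I : ideal S).

(* P I *)
Definition mod_mul P I : {pred P} := fun x => `[< exists (n : nat)
  (s : 'I_n -> S) (p : 'I_n -> P),
  (forall i, s i \in I) /\ x = \sum_(i < n) (s i : S^c) *: p i >].

Arguments mod_mul P I : clear implicits.

(* The sum of the f(P), for f in Hom_S(P, S). *)
Definition trace P : set S := [set x | exists (n : nat)
  (f : 'I_n -> {linear P -> (S^c)^o}) (p : 'I_n -> P),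
  x = \sum_(i < n) (f i (p i) : S)].

Definition trace_ideals : set (ideal S) := [set I |
  exists P, [/\ count_gen P, projective P & [set x | x \in I] = trace P]].

Definition big I P := [/\ count_gen P, projective P &
  forall Q, count_gen Q -> projective Q -> (forall q : Q, q \in mod_mul Q I) ->
  hom_image P Q].

End RightModules.

Arguments mod_mul {S} P I.

Section Reduction.
Variables (S : pzRingType) (P : lmodType S^c) (I : ideal S).

Lemma mod_mul_submod : submod_closed (mod_mul P I).
Proof.
split.
  apply/asboolP; exists 0%N, (fun=> 0), (fun=> 0).
  by split=> [[]|] //; rewrite big_ord0.
move=> a u v /asboolP[m [c [x [Ic ->]]]] /asboolP[n [d [y [Id ->]]]].
apply/asboolP; exists (m + n)%N.
exists (fun i => match fintype.split i with
                 | inl j => c j * (a : S) | inr j => d j end).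
exists (fun i => match fintype.split i with inl j => x j | inr j => y j end).
split; first by move=> i; case: fintype.split => // j; apply: ideal_mulr.
rewrite big_split_ord scaler_sumr; congr (_ + _); apply: eq_bigr => i _.
  by rewrite (unsplitK (inl _ i)) scalerA.
by rewrite (unsplitK (inr _ i)).
Qed.

HB.instance Definition _ :=
  GRing.isSubmodClosed.Build S^c P (mod_mul P I) mod_mul_submod.

(* P / P I, as a right module over S / I. *)
Definition reduction := quot_mod (mod_mul P I).
HB.instance Definition _ := GRing.Zmodule.on reduction.

Definition reduction_scale (a : (quot_ring I)^c) (x : reduction) : reduction :=
  (quot_ring_repr (a : quot_ring I) : S^c) *: (x : quot_mod (mod_mul P I)).

Lemma reduction_scaleE (s : S) (x : reduction) :
  reduction_scale (quot_ring_pi I s) x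
  = (s : S^c) *: (x : quot_mod (mod_mul P I)).
Proof.
rewrite /reduction_scale; set t := quot_ring_repr _.
have Ist : t - s \in I by apply/quot_ring_piP; rewrite quot_ring_reprK.
rewrite -[x]quot_mod_reprK; set p := quot_mod_repr x.
rewrite !quot_mod_scaleE; apply/quot_mod_piP; rewrite -scalerBl.
apply/asboolP; exists 1%N, (fun=> t - s), (fun=> p).
by split=> //; rewrite big_ord1.
Qed.

Lemma reduction_scalerA a b x :
  reduction_scale a (reduction_scale b x) = reduction_scale (a * b) x.
Proof.
rewrite -[a](@quot_ring_reprK S I) -[b](@quot_ring_reprK S I).
set s := quot_ring_repr a; set t := quot_ring_repr b.
rewrite [in LHS]reduction_scaleE reduction_scaleE scalerA.
rewrite [X in reduction_scale X](_ : _ = quot_ring_pi I (t * s)).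
  by rewrite reduction_scaleE.
exact: quot_ring_piM.
Qed.

Lemma reduction_scale1r : left_id 1 reduction_scale.
Proof. by move=> x; rewrite [LHS]reduction_scaleE scale1r. Qed.

Lemma reduction_scalerDr : right_distributive reduction_scale +%R.
Proof. by move=> a x y; apply: scalerDr. Qed.

Lemma reduction_scalerDl x : {morph reduction_scale^~ x : a b / a + b}.
Proof.
move=> a b; rewrite -[a](@quot_ring_reprK S I) -[b](@quot_ring_reprK S I).
rewrite /= -[X in reduction_scale X](@quot_ring_piD S I) !reduction_scaleE.
exact: scalerDl.
Qed.

HB.instance Definition _ :=
  GRing.Zmodule_isLmodule.Build (quot_ring I)^c reduction
  reduction_scalerA reduction_scale1r reduction_scalerDr reduction_scalerDl.

End Reduction.

Section Tensor.
Variables (R : comPzRingType) (M : lmodType R).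
Local Notation S := (endo M).
Variable P : lmodType S^c.

Definition tensor_gen (p : P) (m : M) : dsum (P * M)%type R^o := delta (p, m) (1 : R^o).

Inductive tensor_rel : set (dsum (P * M)%type R^o) :=
| TensorDl p q m :
    tensor_rel (tensor_gen (p + q) m - tensor_gen p m - tensor_gen q m)
| TensorDr p m n :
    tensor_rel (tensor_gen p (m + n) - tensor_gen p m - tensor_gen p n)
| TensorS p (s : S) m :
    tensor_rel (tensor_gen ((s : S^c) *: p) m - tensor_gen p (s m))
| TensorR p r m : tensor_rel (r *: tensor_gen p m - tensor_gen p (r *: m)).

(* P (x)_S M with the R-module structure coming from M, presented over R: the
   relations [TensorR] say that r (p (x) m) = p (x) r m. *)
Definition tensor : lmodType R := quot_mod (span_set tensor_rel).

End Tensor.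

Section Monoids.
Variables (R : comPzRingType) (M : lmodType R).
Local Notation S := (endo M).

Definition V_fin (c : module_class R) := exists N,
  c = iso_class N /\ exists n : nat, is_summand N (dsum 'I_n M).

Definition V_star (c : module_class R) := exists N,
  [/\ c = iso_class N, count_gen N & exists X : Type, is_summand N (dsum X M)].

(* Graphs of the maps iota_I and alpha_I, on representatives of isomorphism
   classes. *)
Definition iota_rel (I : ideal S) (P' : lmodType (quot_ring I)^c)
  (P : lmodType S^c) := big I P /\ isomorphic (reduction P I) P'.

Definition alpha_rel (I : ideal S) (P' : lmodType (quot_ring I)^c)
  (N : lmodType R) := exists2 P, iota_rel P' P & isomorphic (tensor P) N.

Definition B_big (c : module_class R) := exists N, c = iso_class N /\
  exists I : ideal S,
    [/\ trace_ideals I, [set x | x \in I] <> [set 0] &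
     exists P' : lmodType (quot_ring I)^c,
       [/\ fin_gen P', projective P' & alpha_rel P' N]].

End Monoids.

(* Main.v *)
Require Import Defs.
From HB Require Import structures.
From mathcomp Require Import all_boot all_order all_algebra.
From mathcomp Require Import all_classical.

(** Put S = End_R(M).  As M is finitely generated, Hom_R(M, -) and - (x)_S M
match the countably generated summands of sums of copies of M with the
countably generated projective right S-modules, so the matter is to show that
such a projective P is I-big with P / P I finitely generated, for some trace
ideal I.

Let b_i in P and phi_i : P -> S form a dual basis indexed by nat, and let I_n be
the ideal generated by the values of the phi_i with i >= n.  The elements
b_i with i < n generate P modulo P I_n.  Each phi_i(b_j) vanishes for i large
with respect to j, and the expansion phi_i(p) = sum_j phi_i(b_j) phi_j(p)
then shows I_m = I_m I_n for m large with respect to n.  The central fact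
([ideal_chain_stabilizes]) is that over a ring which is noetherian as a module
over a central subring, such as S ([endo_centrally_noetherian]), a decreasing
chain of ideals of this kind is stationary.  Let I be its last term.
- I is idempotent and finitely generated on the left, hence the trace of a
  countably generated projective module ([idempotent_ideal_trace], a
  construction of Whitehead).
- P is I-big ([stable_tail_big]).  Arbitrarily far out there are elements of P
  whose coordinates generate I as a left ideal ([spanning_vector]); choosing
  them with disjoint supports, one maps them independently of each other to
  prescribed generators of any module Q = Q I.
- If I = 0, only finitely many phi_i are nonzero and the module lies in V(M);
  otherwise it lies in B(M).

The two parts are disjoint: P (x)_S M in V(M) forces P to be finitely generated,
whereas an I-big P with I nonzero maps onto a sum of infinitely many copies
of a nonzero projective module ([big_not_fin_gen]).

Stabilization is proved by noetherian induction on an ideal K modulo which the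
chain is not stationary.  A maximal such K is prime.  In the prime ring S / K
there is a nonzero ideal N such that for every prime Q not containing N, the
conditions I <= Q and J I = J force J = 0 ([generic_ideal]).  This plays the
part of the theorem that a prime algebra, finite over its center, is Azumaya
over a dense open set: there, primes of the algebra correspond to primes of
the center and the claim is Nakayama's lemma.  The proof replaces the center by
maps x |-> sum_i a_i x b_i.  By the choice of N, every prime containing K and
a term of the chain contains N; as the chain is stationary modulo N + K, this
makes it stationary modulo K. *)

Set Implicit Arguments.
Unset Strict Implicit.
Unset Printing Implicit Defensive.

Import GRing.Theory.

Local Open Scope classical_set_scope.
Local Open Scope ring_scope.

(** * Abelian groups with operators and the noetherian condition *)

(** Modules over R, and S as a module over a central subset, are treated at once
as abelian groups with a set [A] of operators. *)
Section OperatorGroups.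
Variables (U : zmodType) (A : set (U -> U)).
Implicit Types X J : set U.

Definition op_closed X := [/\ X 0, forall x y, X x -> X y -> X (x - y) &
  forall f x, A f -> X x -> X (f x)].

Lemma op_closedN X x : op_closed X -> X x -> X (- x).
Proof. by case=> X0 XB _ Xx; rewrite -sub0r; apply: XB. Qed.

Lemma op_closedD X x y : op_closed X -> X x -> X y -> X (x + y).
Proof.
move=> cX Xx Xy; rewrite -[y]opprK; case: (cX) => _ XB _.
by apply: XB => //; apply: op_closedN.
Qed.

Lemma op_closed_sum X (I : Type) (r : seq I) (P : pred I) (F : I -> U) :
  op_closed X -> (forall i, P i -> X (F i)) -> X (\sum_(i <- r | P i) F i).
Proof.
move=> cX XF; apply: (big_ind X) => //; first by case: cX.
by move=> x y; apply: op_closedD.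
Qed.

(** Finite generation is phrased by minimality among closed sets, which spares
coefficients of linear combinations. *)
Definition op_fg X := exists s : seq U, (forall a, a \in s -> X a) /\
  forall J, op_closed J -> (forall a, a \in s -> J a) -> X `<=` J.

Definition op_noetherian := forall X, op_closed X -> op_fg X.

(** The union of a strictly increasing sequence of closed sets has its finitely
many generators in one member of the sequence. *)
Lemma op_noetherian_max (F : set (set U)) : op_noetherian ->
    (forall X, F X -> op_closed X) -> F !=set0 ->
  exists2 X, F X & forall Y, F Y -> X `<=` Y -> Y `<=` X.
Proof.
move=> noeth Fclosed [X0 FX0]; apply: contrapT => nomax.
have /choice[next nextP] : forall X, exists Y, F X ->
    [/\ F Y, X `<=` Y & ~ Y `<=` X].
  move=> X; apply: contrapT => noY; apply: nomax; exists X.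
    by apply: contrapT => nFX; apply: noY; exists X.
  move=> Y FY XY; apply: contrapT => nYX; apply: noY; exists Y => _.
  by split.
pose c n := iter n next X0.
have Fc n : F (c n) by elim: n => //= n /nextP[].
have cS n : c n `<=` c n.+1 by have [] := nextP _ (Fc n).
have cle m n : (m <= n)%N -> c m `<=` c n.
  elim: n => [|n IHn]; first by rewrite leqn0 => /eqP->.
  by rewrite leq_eqVlt => /predU1P[->//|/IHn cmn x /cmn /cS].
have cU : op_closed [set x | exists n, c n x].
  split; first by exists 0%N; have [] := Fclosed _ FX0.
    move=> x y [m cx] [n cy]; exists (maxn m n).
    have [_ cB _] := Fclosed _ (Fc (maxn m n)).
    by apply: cB; [apply: (cle m); rewrite ?leq_maxl|
                   apply: (cle n); rewrite ?leq_maxr].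
  by move=> f x Af [n cx]; exists n; have [_ _] := Fclosed _ (Fc n); apply.
have [s [sU Us]] := noeth _ cU.
have [n cns] : exists n, forall a, a \in s -> c n a.
  elim: s sU {Us} => [|a s IHs] sU; first by exists 0%N.
  have [k cka] := sU a (mem_head _ _).
  have [n cns] := IHs (fun b sb => sU b (mem_behead (s := a :: s) sb)).
  exists (maxn k n) => b; rewrite in_cons => /predU1P[->|/cns].
    exact: (cle k _ (leq_maxl _ _)).
  exact: (cle n _ (leq_maxr _ _)).
have [_ _] := nextP _ (Fc n); apply=> x cx.
by apply: (Us _ (Fclosed _ (Fc n)) cns); exists n.+1.
Qed.

End OperatorGroups.

(** Over a noetherian [V], a group that embeds in a finite power of [V] through
the maps [ev i] is noetherian.  The induction is on the number [j] of those maps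
that may be nonzero on the closed set at hand. *)
Lemma op_noetherian_joint_kernel (U V : zmodType) (A : set (U -> U))
    (B : set (V -> V)) (n : nat) (ev : nat -> U -> V) :
    op_noetherian B ->
    (forall i u v, ev i (u - v) = ev i u - ev i v) ->
    (forall i f u, A f -> ev i u = 0 -> ev i (f u) = 0) ->
    (forall g, B g -> exists2 f, A f & forall i u, ev i (f u) = g (ev i u)) ->
    (forall u, (forall i, (i < n)%N -> ev i u = 0) -> u = 0) ->
  op_noetherian A.
Proof.
move=> noethB evB evA BA inj X cX.
have ev0 i : ev i 0 = 0 by rewrite -[X in ev _ X](subrr 0) evB subrr.
suff main j : (j <= n)%N -> forall X, op_closed A X ->
    (forall u i, X u -> (j <= i < n)%N -> ev i u = 0) -> op_fg A X.
  by apply: (main n) => // u i _ /andP[]; rewrite leqNgt => /negPf->.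
elim: j => [|j IHj] jn {cX X}X cX Xker.
  exists [::]; split=> // J [J0 _ _] _ x Xx; rewrite (inj x) // => i i_n.
  exact: Xker.
have [X0 XB XA] := cX.
have image_closed (J : set U) : op_closed A J ->
    op_closed B [set v | exists2 u, (J u /\ X u) & ev j u = v].
  case=> J0 JB JA; split; first by exists 0.
    move=> _ _ [x [Jx Xx] <-] [y [Jy Xy] <-]; exists (x - y); rewrite ?evB //.
    by split; [apply: JB|apply: XB].
  move=> g _ Bg [x [Jx Xx] <-]; have [f Af fg] := BA _ Bg.
  by exists (f x); [split; [apply: JA|apply: XA]|rewrite fg].
(* X is generated by lifts of generators of its image under ev j together with
   generators of the kernel. *)
have [s [sX Xs]] := noethB _ (image_closed _ cX).
have [||t [tX Xt]] := IHj (ltnW jn) [set u | X u /\ ev j u = 0].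
- split; first by [].
    by move=> x y [Xx x0] [Xy y0]; split; [apply: XB|rewrite evB x0 y0 subrr].
  by move=> f x Af [Xx x0]; split; [apply: XA|apply: evA].
- move=> u i [Xu u0] /andP[]; rewrite leq_eqVlt => /predU1P[<-//|ji i_n].
  by apply: Xker => //; rewrite ji.
have [s' [s'X s's]] : exists s' : seq U, (forall a, a \in s' -> X a) /\
    forall v, v \in s -> exists2 u, u \in s' & ev j u = v.
  elim: s sX {Xs} => [|v s IHs] sX; first by exists [::].
  have [s' [s'X s's]] := IHs (fun w ws => sX w (mem_behead (s := v :: s) ws)).
  have [u [Xu _] uv] := sX v (mem_head _ _).
  exists (u :: s'); split=> [a|w]; rewrite in_cons => /predU1P[->//|].
  - exact: s'X.
  - by exists u => //; apply: mem_head.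
  - by move=> /s's[u' u's' <-]; exists u' => //; rewrite in_cons u's' orbT.
exists (s' ++ t); split=> [a|J cJ Jst x Xx].
  by rewrite mem_cat => /orP[/s'X//|/tX[]].
have [||u [Ju Xu] uv] := Xs _ (image_closed J cJ) _ (ev j x).
- move=> v /s's[u us' <-]; exists u => //; split; last exact: s'X.
  by apply: Jst; rewrite mem_cat us'.
- by exists x.
have Jxu : J (x - u).
  apply: (Xt J cJ) => [a ta|]; first by apply: Jst; rewrite mem_cat ta orbT.
  by split; [apply: XB|rewrite evB uv subrr].
by rewrite -(subrK u x); apply: (op_closedD cJ).
Qed.

Lemma op_noetherian_image (U V : zmodType) (A : set (U -> U))
    (B : set (V -> V)) (h : U -> V) :
    op_noetherian A ->
    (forall u v, h (u - v) = h u - h v) ->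
    (forall f, A f -> exists2 g, B g & forall u, h (f u) = g (h u)) ->
    (forall g, B g -> exists2 f, A f & forall u, h (f u) = g (h u)) ->
    (forall v, exists u, h u = v) ->
  op_noetherian B.
Proof.
move=> noethA hB hA hBA surj Y [Y0 YB YA].
have h0 : h 0 = 0 by rewrite -[X in h X](subrr 0) hB subrr.
have pre_closed (J : set V) : op_closed B J -> op_closed A [set u | J (h u)].
  case=> J0 JB JA; split; first by rewrite /= h0.
    by move=> x y Jx Jy /=; rewrite hB; apply: JB.
  by move=> f x /hA[g Bg fg] Jx /=; rewrite fg; apply: JA.
have [s [sY Ys]] : op_fg A [set u | Y (h u)] by apply/noethA/pre_closed.
exists (map h s); split=> [_ /mapP[u us ->]|J cJ Js y Yy]; first exact: sY.
have [u uy] := surj y; rewrite -uy; apply: (Ys _ (pre_closed J cJ)).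
  by move=> a as_ /=; apply: Js; apply: map_f.
by rewrite /= uy.
Qed.

(** * Ideals as sets *)
Section Ideals.
Variable S : pzRingType.
Implicit Types I J K X Y : set S.

Definition left_ideal X := [/\ X 0, forall x y, X x -> X y -> X (x - y) &
  forall s x, X x -> X (s * x)].

Definition two_sided X := left_ideal X /\ forall s x, X x -> X (x * s).

Lemma left_idealN X x : left_ideal X -> X x -> X (- x).
Proof. by case=> X0 XB _ Xx; rewrite -sub0r; apply: XB. Qed.

Lemma left_idealD X x y : left_ideal X -> X x -> X y -> X (x + y).
Proof.
move=> lX Xx Xy; rewrite -[y]opprK; case: (lX) => _ XB _.
by apply: XB => //; apply: left_idealN.
Qed.

Lemma left_ideal_sum X (I : Type) (r : seq I) (P : pred I) (F : I -> S) :
  left_ideal X -> (forall i, P i -> X (F i)) -> X (\sum_(i <- r | P i) F i).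
Proof.
move=> lX XF; apply: (big_ind X) => //; first by case: lX.
by move=> x y; apply: left_idealD.
Qed.

Lemma left_ideal_subL X x y : left_ideal X -> X (x - y) -> X y -> X x.
Proof. by move=> lX Xxy Xy; rewrite -(subrK y x); apply: left_idealD. Qed.

Definition ideal_add I J := [set x | exists y z, [/\ I y, J z & x = y + z]].

Lemma left_ideal_add I J : left_ideal I -> left_ideal J ->
  left_ideal (ideal_add I J).
Proof.
move=> lI lJ; have [I0 IB IM] := lI; have [J0 JB JM] := lJ; split.
- by exists 0, 0; split; rewrite ?addr0.
- move=> _ _ [x [y [Ix Jy ->]]] [z [t [Iz Jt ->]]]; exists (x - z), (y - t).
  by split; [apply: IB|apply: JB|rewrite opprD addrACA].
- move=> s _ [x [y [Ix Jy ->]]]; exists (s * x), (s * y).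
  by split; [apply: IM|apply: JM|rewrite mulrDr].
Qed.

Lemma two_sided_add I J : two_sided I -> two_sided J ->
  two_sided (ideal_add I J).
Proof.
move=> [lI IM] [lJ JM]; split; first exact: left_ideal_add.
move=> s _ [x [y [Ix Jy ->]]]; exists (x * s), (y * s).
by split; [apply: IM|apply: JM|rewrite mulrDl].
Qed.

Lemma ideal_addl I J : left_ideal J -> I `<=` ideal_add I J.
Proof. by case=> J0 _ _ x Ix; exists x, 0; split; rewrite ?addr0. Qed.

Lemma ideal_addr I J : left_ideal I -> J `<=` ideal_add I J.
Proof. by case=> I0 _ _ x Ix; exists 0, x; split; rewrite ?add0r. Qed.

Lemma ideal_add_sub I J K : left_ideal K -> I `<=` K -> J `<=` K ->
  ideal_add I J `<=` K.
Proof. by move=> lK IK JK _ [y [z [/IK Ky /JK Kz ->]]]; apply: left_idealD. Qed.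

(** The product ideal, as the least subgroup that contains the products. *)
Definition ideal_mul I J : set S := [set x | forall K : set S, K 0 ->
  (forall a b, K a -> K b -> K (a - b)) ->
  (forall a b, I a -> J b -> K (a * b)) -> K x].

Lemma ideal_mul_gen I J a b : I a -> J b -> ideal_mul I J (a * b).
Proof. by move=> Ia Jb K _ _; apply. Qed.

Lemma ideal_mul_left I J : left_ideal I -> left_ideal (ideal_mul I J).
Proof.
case=> I0 IB IM; split.
- by move=> K.
- move=> x y Kx Ky K K0 KB KM.
  by apply: (KB); [exact: (Kx K K0 KB KM)|exact: (Ky K K0 KB KM)].
- move=> s x Kx; apply: (Kx [set x | ideal_mul I J (s * x)]).
  + by rewrite /= mulr0 => K.
  + move=> a b Ka Kb /= K K0 KB KM.
    rewrite mulrBr.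
    by apply: (KB); [exact: (Ka K K0 KB KM)|exact: (Kb K K0 KB KM)].
  + by move=> a b Ia Jb /=; rewrite mulrA; apply: ideal_mul_gen => //; apply: IM.
Qed.

Lemma ideal_mul_sub I J K : left_ideal K ->
  (forall a b, I a -> J b -> K (a * b)) -> ideal_mul I J `<=` K.
Proof. by case=> K0 KB _ KM x; apply. Qed.

(** The whole ring counts as prime here. *)
Definition prime_ideal K := two_sided K /\
  forall a b, (forall s, K (a * s * b)) -> K a \/ K b.

Definition left_span X := [set x | forall J, left_ideal J -> X `<=` J -> J x].

Lemma left_span_ideal X : left_ideal (left_span X).
Proof.
split=> [J []//|x y Jx Jy J lJ XJ|s x Jx J lJ XJ]; have [J0 JB JM] := lJ.
  by apply: (JB); [exact: (Jx J lJ XJ)|exact: (Jy J lJ XJ)].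
by apply: (JM); exact: (Jx J lJ XJ).
Qed.

Lemma left_span_gen X : X `<=` left_span X.
Proof. by move=> x Xx J _; apply. Qed.

Lemma left_span_min X J : left_ideal J -> X `<=` J -> left_span X `<=` J.
Proof. by move=> lJ XJ x; apply. Qed.

Lemma left_span_two_sided X : (forall s x, X x -> X (x * s)) ->
  two_sided (left_span X).
Proof.
move=> XM; split; first exact: left_span_ideal.
move=> s; apply: (@left_span_min X [set x | left_span X (x * s)]); last first.
  by move=> x Xx; apply: left_span_gen; apply: XM.
have [L0 LB LM] := left_span_ideal X; split.
- by rewrite /= mul0r.
- by move=> x y Lx Ly; rewrite /= mulrBl; apply: LB.
- by move=> t x Lx; rewrite /= -mulrA; apply: LM.
Qed.

(** The ideal is K + SaS. *)
Lemma adjoin_ideal K a : two_sided K -> exists J, [/\ two_sided J, K `<=` J, J a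
  & forall J', two_sided J' -> K `<=` J' -> J' a -> J `<=` J'].
Proof.
move=> tK; pose X := [set x | K x \/ exists s, x = a * s].
exists (left_span X); split.
- apply: left_span_two_sided => s x [Kx|[t ->]]; last first.
    by right; exists (t * s); rewrite mulrA.
  by left; apply: (tK.2).
- by move=> x Kx; apply: left_span_gen; left.
- by apply: left_span_gen; right; exists 1; rewrite mulr1.
- move=> J' tJ' KJ' J'a; apply: left_span_min; first exact: (tJ'.1).
  by move=> x [/KJ'//|[s ->]]; apply: (tJ'.2).
Qed.

End Ideals.

(** * Stabilization of chains of ideals *)
Section MultiplicationMaps.
Variable S : pzRingType.

(** These maps form the image of S (x) S^op in the additive endomorphisms of S. *)
Definition mulmap (f : S -> S) :=
  exists l : seq (S * S), forall x, f x = \sum_(t <- l) t.1 * x * t.2.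

Lemma mulmapM a b : mulmap (fun x => a * x * b).
Proof. by exists [:: (a, b)] => x; rewrite big_seq1. Qed.

Lemma mulmapD f g : mulmap f -> mulmap g -> mulmap (fun x => f x + g x).
Proof. by move=> [l fl] [m gm]; exists (l ++ m) => x; rewrite big_cat fl gm. Qed.

Lemma mulmapMl a f : mulmap f -> mulmap (fun x => a * f x).
Proof.
move=> [l fl]; exists [seq (a * t.1, t.2) | t <- l] => x.
by rewrite big_map fl mulr_sumr; apply: eq_bigr => t _; rewrite !mulrA.
Qed.

Lemma mulmapMr b f : mulmap f -> mulmap (fun x => f x * b).
Proof.
move=> [l fl]; exists [seq (t.1, t.2 * b) | t <- l] => x.
by rewrite big_map fl mulr_suml; apply: eq_bigr => t _; rewrite !mulrA.
Qed.

Lemma mulmap0 : mulmap (fun=> 0).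
Proof. by exists [::] => x; rewrite big_nil. Qed.

Lemma mulmapB f g : mulmap f -> mulmap g -> mulmap (fun x => f x - g x).
Proof.
move=> mf mg; have := mulmapD mf (mulmapMl (-1) mg).
by move=> [l fl]; exists l => x; rewrite -fl mulN1r.
Qed.

Lemma mulmap_sum (I : eqType) (r : seq I) (F : I -> S -> S) :
  (forall i, i \in r -> mulmap (F i)) -> mulmap (fun x => \sum_(i <- r) F i x).
Proof.
elim: r => [|i r IHr] mF; first by exists [::] => x; rewrite !big_nil.
have [l fl] : mulmap (fun x => \sum_(i <- r) F i x).
  by apply: IHr => j rj; apply: mF; rewrite in_cons rj orbT.
have [m fm] := mF i (mem_head _ _); exists (m ++ l) => x.
by rewrite big_cons big_cat /= -fl -fm.
Qed.

Lemma mulmap_ideal (J : set S) f x : two_sided J -> mulmap f -> J x -> J (f x).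
Proof.
move=> [lJ JM] [l fl] Jx; rewrite fl; apply: left_ideal_sum => // t _.
by apply: JM; case: lJ => _ _; apply.
Qed.

Lemma mulmap_sub f x y : mulmap f -> f (x - y) = f x - f y.
Proof.
by move=> [l fl]; rewrite !fl -sumrB; apply: eq_bigr => t _; rewrite mulrBr mulrBl.
Qed.

End MultiplicationMaps.

Section Stabilization.
Variable S : pzRingType.
Implicit Types I J K N Q X Y : set S.

Definition ideal_acc := forall F : set (set S), F !=set0 ->
  (forall X, F X -> two_sided X) ->
  exists2 X, F X & forall Y, F Y -> X `<=` Y -> Y `<=` X.

(** For S finite over a central subring, module generators determine all
multiplication maps.  This and the ascending chain condition are the two
finiteness properties behind stabilization. *)
Definition determines K (s : seq S) := forall f, mulmap f ->
  (forall a, a \in s -> K (f a)) -> forall x, K (f x).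

Hypothesis acc : ideal_acc.
Hypothesis det : exists s, forall K, two_sided K -> determines K s.

Section PrimeFactor.
Variable K : set S.
Hypothesis K_prime : prime_ideal K.
Hypothesis K_proper : ~ K 1.

Let K_two_sided : two_sided K := K_prime.1.

(** In a determining set of least size each element can be separated from the
others.  This is linear independence over the extended centroid of S / K, in
the guise of the density theorem. *)
Lemma minimal_determining : exists s : seq S, [/\ uniq s, determines K s &
  forall b, b \in s -> exists f, [/\ mulmap f, ~ K (f b) &
    forall a, a \in s -> a != b -> K (f a)]].
Proof.
pose P k := `[<exists s, [/\ uniq s, determines K s & size s = k]>].
have exP : exists k, P k.
  have [s dets] := det; exists (size (undup s)); apply/asboolP.
  exists (undup s); split=> //; first exact: undup_uniq.
  move=> f mf Kf; apply: (dets K) => // a sa; apply: Kf.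
  by rewrite mem_undup.
have [k /asboolP[s [us dets sk]] kmin] := ex_minnP exP.
exists s; split=> // b sb; apply: contrapT => nof.
suff : P (size (rem b s)).
  move=> /kmin; rewrite -sk size_rem // leqNgt ltn_predL.
  by case: (s) sb.
apply/asboolP; exists (rem b s); split=> //; first exact: rem_uniq.
move=> f mf Kf; apply: (dets f mf) => a sa.
have Kfb c : c \in s -> c != b -> K (f c).
  by move=> sc cb; apply: Kf; rewrite mem_rem_uniq // inE cb.
have [->|] := eqVneq a b; last exact: Kfb.
by apply: contrapT => nKfb; apply: nof; exists f; split.
Qed.

(** The intersection contains the product, which is not inside a prime. *)
Lemma prime_not_sub_inter (s : seq S) (N : S -> set S) :
    (forall b, b \in s -> two_sided (N b) /\ ~ N b `<=` K) ->
  exists N0, [/\ two_sided N0, ~ N0 `<=` K &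
    forall b, b \in s -> N0 `<=` N b].
Proof.
elim: s => [|b s IHs] Ns.
  exists setT; split=> //.
  by move=> /(_ 1 I).
have [|N0 [tN0 N0K N0s]] := IHs.
  by move=> c sc; apply: Ns; rewrite in_cons sc orbT.
have [[lNb NbM] NbK] := Ns b (mem_head _ _).
have [Nb0 NbB NbMl] := lNb; have [[N00 N0B N0Ml] N0M] := tN0.
exists (N0 `&` N b); split.
- split; last by move=> t x [? ?]; split; [apply: N0M|apply: NbM].
  by split=> // [x y [? ?] [? ?]|t x [? ?]]; split; auto.
- move=> sub; move/existsNP: N0K => [x /not_implyP[N0x nKx]].
  move/existsNP: NbK => [y /not_implyP[Nby nKy]].
  have [] // := K_prime.2 x y => t; apply: sub; split.
    by do 2!apply: (N0M).
  exact: NbMl.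
- by move=> c; rewrite in_cons => /predU1P[->|/N0s sub] x [] // /sub.
Qed.

(** Let [B] be a minimal determining set.  [N] consists of elements n such that
for every b in [B] some multiplication map takes the value n at b and vanishes
on the rest of [B], modulo [K].  Modulo [K], its value at y depends only on n
and is a bimodule map in n: it is multiplication by a coordinate of y with
respect to [B], an element of the extended centroid of S / K.  Such partial
bimodule maps commute with each other, and every y is a combination of
elements of [B] with its coordinates as coefficients.  So a prime Q not
containing N behaves as a prime of a commutative ring, and Nakayama's lemma for
J = J I localized at Q can be proved by hand. *)
Lemma generic_ideal : exists N, [/\ two_sided N, ~ N `<=` K &
  forall Q I J, prime_ideal Q -> K `<=` Q -> two_sided I -> two_sided J ->
    I `<=` Q -> J `<=` ideal_mul J I -> ~ J `<=` K -> N `<=` Q].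
Proof.
have [lK KM] := K_two_sided; have [K0 KB KMl] := lK.
have [B [uB detB Bmin]] := minimal_determining.
(* M b: the multiplication maps that vanish on B minus b modulo K. *)
pose M b f := mulmap f /\ forall a, a \in B -> a != b -> K (f a).
have MB b f g : M b f -> M b g -> M b (fun x => f x - g x).
  move=> [mf Kf] [mg Kg]; split; first exact: mulmapB.
  by move=> a Ba ab; apply: KB; [apply: Kf|apply: Kg].
have Ml b f t : M b f -> M b (fun x => t * f x).
  move=> [mf Kf]; split; first exact: mulmapMl.
  by move=> a Ba ab; apply: KMl; apply: Kf.
have Mr b f t : M b f -> M b (fun x => f x * t).
  move=> [mf Kf]; split; first exact: mulmapMr.
  by move=> a Ba ab; apply: KM; apply: Kf.
have M0 b : M b (fun=> 0) by split=> //; apply: mulmap0.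
have [|N [tN nNK NB]] := prime_not_sub_inter (s := B)
    (N := fun b => [set x | exists2 f, M b f & f b = x]).
  move=> b Bb; split.
    split; first split.
    - by exists (fun=> 0).
    - by move=> _ _ [f Mf <-] [g Mg <-]; exists (fun x => f x - g x); auto.
    - by move=> t _ [f Mf <-]; exists (fun x => t * f x); auto.
    - by move=> t _ [f Mf <-]; exists (fun x => f x * t); auto.
  have [f [mf nKfb Kf]] := Bmin b Bb; move=> /(_ (f b)) fbK.
  by apply/nKfb/fbK; exists f.
have [[N0 NB_ NMl] NM] := tN.
exists N; split=> // Q I J prQ KQ tI tJ IQ JJI nJK.
have [[lQ QM] Qprime] := prQ; have [Q0 QB QMl] := lQ.
have [[J0 JB JMl] JM] := tJ.
apply: contrapT => nNQ.
(* m (b, n) has the value n at b; its value at y is the b-coordinate of y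
   applied to n. *)
have /choice[m mP] : forall p : S * S, exists f,
    p.1 \in B -> N p.2 -> M p.1 f /\ f p.1 = p.2.
  move=> [b n] /=; have [|nb] := boolP (b \in B); last by exists id.
  move=> /NB NBb; have [/NBb[f Mf fb]|nN] := pselect (N n); last by exists id.
  by exists f.
have mM b n : b \in B -> N n -> M b (m (b, n)) by move=> bB Nn; case: (mP (b, n)).
have mb b n : b \in B -> N n -> m (b, n) b = n.
  by move=> bB Nn; case: (mP (b, n)).
(* A sum over B of terms that vanish modulo K except at b. *)
have sum_mod (G : S -> S) b : b \in B ->
    (forall c, c \in B -> c != b -> K (G c)) -> K (G b - \sum_(c <- B) G c).
  move=> Bb KG; rewrite (big_rem b) //= opprD addrA subrr add0r.
  apply: left_idealN => //; rewrite big_seq; apply: left_ideal_sum => // c.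
  by rewrite mem_rem_uniq // !inE => /andP[cb Bc]; apply: KG.
(* The two expansions hold on B, hence everywhere.  The second one moves the
   coordinates of x past p, which shows N J I <= I J modulo K. *)
have expand_right y n : N n -> K (y * n - \sum_(b <- B) b * m (b, n) y).
  move=> Nn.
  apply: (detB (fun y => y * n - \sum_(b <- B) b * m (b, n) y)) => [|a Ba].
    apply: mulmapB; last first.
      by apply: mulmap_sum => b Bb; apply/mulmapMl/(mM _ _ Bb Nn).1.
    by have [l fl] := mulmapM 1 n; exists l => x; rewrite -fl mul1r.
  rewrite -[X in a * X - _](mb a n Ba Nn).
  apply: (sum_mod (fun b => b * m (b, n) a)) => // c Bc ca.
  by apply: KMl; apply: (mM c n Bc Nn).2 => //; rewrite eq_sym.
have expand_mid n p x : N n -> K (n * p * x - \sum_(b <- B) m (b, n) x * p * b).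
  move=> Nn.
  apply: (detB (fun x => n * p * x - \sum_(b <- B) m (b, n) x * p * b)) => [|a Ba].
    apply: mulmapB; last first.
      by apply: mulmap_sum => b Bb; do 2!apply: (mulmapMr); apply: (mM _ _ Bb Nn).1.
    by have [l fl] := mulmapM (n * p) 1; exists l => t; rewrite -fl mulr1.
  rewrite -[X in X * p * a - _](mb a n Ba Nn).
  apply: (sum_mod (fun b => m (b, n) a * p * b)) => // c Bc ca.
  by do 2!apply: (KM); apply: (mM c n Bc Nn).2 => //; rewrite eq_sym.
(* Y is maximal among the ideals for which J u <= Y implies that u is in Q.  So
   a larger ideal contains J u for some u outside Q, as if J / Y were a simple
   bimodule after localization at Q. *)
have [Y [tY KY YQ] Ymax] : exists2 Y, [/\ two_sided Y, K `<=` Y &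
      forall u, (forall p, J p -> Y (p * u)) -> Q u] &
    forall Y', [/\ two_sided Y', K `<=` Y' &
      forall u, (forall p, J p -> Y' (p * u)) -> Q u] -> Y `<=` Y' -> Y' `<=` Y.
  apply: acc => [|X []//]; exists K; split=> // u Ku.
  move/existsNP: nJK => [p /not_implyP[Jp nKp]]; apply: KQ.
  have [] // := K_prime.2 p u => t; apply: Ku; exact: JM.
have [lY YM] := tY; have [Y0 YB YMl] := lY.
have [n [y [Nn Jy nYyn]]] : exists n y, [/\ N n, J y & ~ Y (y * n)].
  apply: contrapT => no; apply: nNQ => n Nn; apply: YQ => p Jp.
  by apply: contrapT => nY; apply: no; exists n, p.
have [b [Bb nYmu]] : exists b, b \in B /\ ~ Y (m (b, n) y).
  apply: contrapT => no; apply: nYyn.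
  apply: (left_ideal_subL lY (KY _ (expand_right y n Nn))).
  rewrite big_seq; apply: left_ideal_sum => // b Bb; apply: YMl.
  by apply: contrapT => nY; apply: no; exists b.
(* V is the image of the bimodule map v given by the b-coordinate of y.  It is
   not inside Y, so it contains J u modulo Y for some u outside Q. *)
pose V := [set x | exists f, [/\ M b f, N (f b) & f y = x]].
have tV : two_sided V.
  split; first split.
  - by exists (fun=> 0).
  - move=> _ _ [f [Mf Nf <-]] [g [Mg Ng <-]]; exists (fun x => f x - g x).
    by split; [apply: MB|apply: NB_|].
  - move=> t _ [f [Mf Nf <-]]; exists (fun x => t * f x).
    by split; [apply: Ml|apply: NMl|].
  - move=> t _ [f [Mf Nf <-]]; exists (fun x => f x * t).
    by split; [apply: Mr|apply: NM|].
have [u JuVY nQu] : exists2 u, (forall p, J p -> ideal_add V Y (p * u)) & ~ Q u.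
  apply: contrapT => no.
  have VYY : ideal_add V Y `<=` Y.
    apply: Ymax; last by apply: ideal_addr; case: tV.
    split; first exact: two_sided_add.
      by move=> x /KY; apply: ideal_addr; case: tV.
    by move=> u Ju; apply: contrapT => nQu; apply: no; exists u.
  apply: nYmu; apply: VYY; apply: ideal_addl => //.
  by exists (m (b, n)); split=> //; [apply: mM|rewrite mb].
(* The kernel of v : N -> V / (V meet Y) lies in Q: for n0 in it and p = v(n),
   the identity v(n) n0 = n v(n0) gives J u n0 <= Y. *)
have N0Q f : M b f -> N (f b) -> Y (f y) -> Q (f b).
  move=> [mf Kf] Nf Yf.
  have [] // := Qprime u (f b) => s; apply: YQ => p Jp.
  have [_ [y' [[g [[mg Kg] Ng <-]] Yy' pu]]] := JuVY p Jp.
  rewrite mulrA (mulrA p) pu mulrDl mulrDl; apply: (left_idealD lY).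
    2: by do 2!apply: (YM).
  have swap : K (g y * s * f b - g b * s * f y).
    apply: (detB (fun x => g x * s * f b - g b * s * f x)) => [|a Ba].
      by apply: mulmapB; [do 2!apply: (mulmapMr)|apply: mulmapMl].
    have [->|ab] := eqVneq a b; first by rewrite subrr.
    by apply: KB; [do 2!apply: (KM); apply: Kg|apply: KMl; apply: Kf].
  by apply: (left_ideal_subL lY (KY _ swap)); apply: YMl.
(* G is Y plus the image under v of the meet of N and Q, and contains Q V + Y.
   The inclusions N J u <= N J I u <= I J u <= Q V + Y thus compare v(n1 n2 u)
   with v of an element of Q; as the kernel is in Q, so is n1 n2 u. *)
pose G := [set v | exists f, [/\ M b f, N (f b), Q (f b) & Y (v - f y)]].
have lG : left_ideal G.
  split.
  - by exists (fun=> 0); rewrite subr0.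
  - move=> v w [f [Mf Nf Qf Yf]] [g [Mg Ng Qg Yg]]; exists (fun x => f x - g x).
    split; [exact: MB|exact: NB_|exact: QB|].
    have -> : v - w - (f y - g y) = (v - f y) - (w - g y).
      by rewrite opprB [in RHS]opprB addrACA [RHS]addrACA (addrC (- w)).
    exact: YB.
  - move=> t v [f [Mf Nf Qf Yf]]; exists (fun x => t * f x).
    by split; [apply: Ml|apply: NMl|apply: QMl|rewrite -mulrBr; apply: YMl].
have YG : Y `<=` G by move=> v Yv; exists (fun=> 0); rewrite subr0.
have QVG q v : Q q -> ideal_add V Y v -> G (q * v).
  move=> Qq [_ [y' [[f [Mf Nf <-]] Yy' ->]]]; exists (fun x => q * f x).
  split; [exact: Ml|exact: NMl|exact: QM|].
  by rewrite -mulrBr addrC addrA addNr add0r; apply: YMl.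
have NJu n1 w : N n1 -> J w -> G (n1 * w * u).
  move=> Nn1 /JJI Jw; apply: (Jw [set w | G (n1 * w * u)]).
  - by rewrite /= mulr0 mul0r; case: lG.
  - by move=> v v' Gv Gv' /=; rewrite mulrBr mulrBl; case: lG => _ + _; apply.
  - move=> p x Jp Ix /=; rewrite mulrA.
    have mid : G (n1 * p * x * u - (\sum_(c <- B) m (c, n1) x * p * c) * u).
      by rewrite -mulrBl; apply: YG; apply: YM; apply: KY; apply: expand_mid.
    apply: (left_ideal_subL lG mid).
    rewrite mulr_suml big_seq; apply: left_ideal_sum => // c Bc.
    rewrite -!mulrA; apply: QVG; last by rewrite mulrA; apply: JuVY; apply: JM.
    by apply: IQ; apply: (mulmap_ideal tI (mM c n1 Bc Nn1).1).
have NNu n1 n2 : N n1 -> N n2 -> Q (n1 * n2 * u).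
  move=> Nn1 Nn2; have [mf Kf] := mM b n2 Bb Nn2.
  have [|f [Mf Nf Qf Yf]] := NJu n1 (m (b, n2) y) Nn1.
    exact: (mulmap_ideal tJ mf).
  apply: (left_ideal_subL lQ _ Qf).
  have := N0Q (fun x => n1 * m (b, n2) x * u - f x).
  rewrite mb //; apply=> //; first by apply: MB => //; apply: Mr; apply: Ml; split.
  by apply: NB_ => //; apply: NM; apply: NMl.
move/existsNP: nNQ => [n0 /not_implyP[Nn0 nQn0]].
have [] // := Qprime n0 u => s.
have [] // := Qprime n0 (n0 * s * u) => t.
rewrite !mulrA -(mulrA (n0 * t)); apply: NNu; apply: NM => //.
Qed.

End PrimeFactor.

(** If the chain is stationary modulo two ideals A and B with AB inside K, it is
stationary modulo K, because late terms satisfy I_m = I_m I_n.  Hence an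
ideal [K] maximal among those modulo which it is not stationary is prime.  Let
[N] be as in [generic_ideal] and [n0] an index from which the chain is
stationary modulo N + K.  If I_n1 is not inside I_M + K for some n1 such that
I_n1 = I_n1 I_n0, let Q be a maximal ideal among those that contain
I_M + K but not I_n1.  The ideal T of all s with I_n1 s <= Q is prime and contains
I_M, so it contains N and therefore I_n0, which gives I_n1 = I_n1 I_n0 <= Q. *)
Theorem ideal_chain_stabilizes (I : nat -> set S) :
    (forall n, two_sided (I n)) -> (forall n, I n.+1 `<=` I n) ->
    (forall n, exists m0, forall m, (m0 <= m)%N -> I m `<=` ideal_mul (I m) (I n)) ->
  exists n0, forall m, (n0 <= m)%N -> I n0 `<=` I m.
Proof.
move=> tI IS Imul.
have Ile m n : (m <= n)%N -> I n `<=` I m.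
  elim: n => [|n IHn]; first by rewrite leqn0 => /eqP->.
  by rewrite leq_eqVlt => /predU1P[->//|/IHn cmn x /IS /cmn].
pose stable K := exists n0, forall m, (n0 <= m)%N -> I n0 `<=` ideal_add (I m) K.
have lI n : left_ideal (I n) by case: (tI n).
suff [n0 n0P] : stable [set 0].
  by exists n0 => m /n0P sub x /sub[y [_ [Iy -> ->]]]; rewrite addr0.
apply: contrapT => unstable0.
have [K [tK unstable] Kmax] : exists2 K, two_sided K /\ ~ stable K &
    forall Y, two_sided Y /\ ~ stable Y -> K `<=` Y -> Y `<=` K.
  apply: acc => [|X []//]; exists [set 0]; split=> //.
  split; first split=> //.
  - by move=> _ _ -> ->; rewrite subr0.
  - by move=> s _ ->; rewrite /= mulr0.
  - by move=> s _ ->; rewrite /= mul0r.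
have [lK KM] := tK; have [K0 KB KMl] := lK.
have stableS X : two_sided X -> K `<=` X -> ~ X `<=` K -> stable X.
  by move=> tX KX; apply: contra_notP => nX; apply: Kmax.
have K_proper : ~ K 1.
  move=> K1; apply: unstable; exists 0%N => m _ x _; apply: ideal_addr => //.
  by rewrite -[x]mulr1; apply: KMl.
have K_prime : prime_ideal K.
  split=> // a b Kab; apply: contrapT => /not_orP[nKa nKb].
  have [A [tA KA Aa Amin]] := adjoin_ideal a tK.
  have [B [tB KB' Bb Bmin]] := adjoin_ideal b tK.
  have AB x y : A x -> B y -> K (x * y).
    move=> Ax; apply: (Amin [set x | forall y, B y -> K (x * y)] _ _ _ _ Ax).
    - split; first split.
      + by move=> z _; rewrite /= mul0r.
      + by move=> z t Kz Kt w Bw; rewrite /= mulrBl; apply: KB; [apply: Kz|apply: Kt].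
      + by move=> s z Kz w Bw; rewrite /= -mulrA; apply: KMl; apply: Kz.
      + by move=> s z Kz w Bw; rewrite /= -mulrA; apply: Kz; case: tB => [[_ _]]; auto.
    - by move=> z Kz w _; apply: KM.
    - move=> z Bz; rewrite -[a]mulr1.
      apply: (Bmin [set y | forall s, K (a * s * y)] _ _ _ _ Bz) => //.
      + split; first split.
        * by move=> s; rewrite /= mulr0.
        * by move=> v w Kv Kw s; rewrite /= mulrBr; apply: KB; [apply: Kv|apply: Kw].
        * by move=> t v Kv s; rewrite /= mulrA -(mulrA a); apply: Kv.
        * by move=> t v Kv s; rewrite /= mulrA; apply: KM; apply: Kv.
      + by move=> v Kv s; apply: KMl.
  have [nA nAP] : stable A by apply: stableS => // /(_ a Aa).
  have [nB nBP] : stable B by apply: stableS => // /(_ b Bb).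
  pose n1 := maxn nA nB; have [m0 m0P] := Imul n1.
  apply: unstable; exists (maxn m0 n1) => m; rewrite geq_max => /andP[m0m n1m] x Ix.
  have lIK : left_ideal (ideal_add (I m) K) by apply: left_ideal_add.
  apply: (ideal_mul_sub lIK _ (m0P _ (leq_maxl _ _) _ Ix)) => p q Ip Iq.
  have [||i [al [Ii Aal ->]]] := nAP m _ p.
  - by apply: leq_trans n1m; apply: leq_maxl.
  - by apply: Ile Ip; rewrite leq_max leq_maxl orbT.
  have [||j [be [Ij Bbe qE]]] := nBP m _ q.
  - by apply: leq_trans n1m; apply: leq_maxr.
  - by apply: Ile Iq; apply: leq_maxr.
  exists (i * q + al * j), (al * be); split; last by rewrite mulrDl -addrA -mulrDr -qE.
    apply: (left_idealD (lI m)); first exact: (tI m).2.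
    by case: (lI m) => _ _; apply.
  exact: AB.
have [N [tN nNK Ngen]] := generic_ideal K_prime K_proper.
have [lN NM] := tN.
have [n0 n0P] : stable (ideal_add N K).
  apply: stableS; [exact: two_sided_add|exact: ideal_addr|].
  by move=> sub; apply: nNK => x Nx; apply: sub; apply: ideal_addl.
have [m0 m0P] := Imul n0; apply: (unstable); exists (maxn m0 n0) => M.
set n1 := maxn m0 n0 => n1M; apply: contrapT => nsub.
have [Q [tQ JQ nIQ] Qmax] : exists2 Q, [/\ two_sided Q, ideal_add (I M) K `<=` Q &
      ~ I n1 `<=` Q] &
    forall Y, [/\ two_sided Y, ideal_add (I M) K `<=` Y & ~ I n1 `<=` Y] ->
      Q `<=` Y -> Y `<=` Q.
  apply: acc => [|X []//]; exists (ideal_add (I M) K); split=> //.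
  exact: two_sided_add.
have [lQ QM] := tQ; have [Q0 QB QMl] := lQ.
pose T := [set s | forall x, I n1 x -> Q (x * s)].
have QT : Q `<=` T by move=> s Qs x _; apply: QMl.
have tT : two_sided T.
  split; first split.
  - by move=> x _; rewrite /= mulr0.
  - by move=> s t Ts Tt x Ix; rewrite /= mulrBr; apply: QB; [apply: Ts|apply: Tt].
  - by move=> s t Tt x Ix; rewrite /= mulrA; apply: Tt; apply: (tI n1).2.
  - by move=> s t Tt x Ix; rewrite /= mulrA; apply: QM; apply: Tt.
have prT : prime_ideal T.
  split=> // s t Tst; apply: contrapT.
  move=> /not_orP[/existsNP[x /not_implyP[Ix nQxs]] nTt].
  apply: nTt => z Iz.
  have [A [tA QA Axs Amin]] := adjoin_ideal (x * s) tQ.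
  have IA : I n1 `<=` A.
    apply: contrapT => nIA; apply: nQxs; apply: (Qmax A) => //.
    by split=> // w /JQ/QA.
  rewrite -[z]mulr1; apply: (Amin [set a | forall r, Q (a * r * t)]) (IA _ Iz) 1.
  - split; first split.
    + by move=> r; rewrite /= !mul0r.
    + by move=> v w Qv Qw r; rewrite /= !mulrBl; apply: QB; [apply: Qv|apply: Qw].
    + by move=> r v Qv r'; rewrite /= -!mulrA; apply: QMl; rewrite mulrA; apply: Qv.
    + by move=> r v Qv r'; rewrite /= -(mulrA v); apply: Qv.
  - by move=> v Qv r; do 2!apply: (QM).
  - by move=> r; rewrite /= -!mulrA (mulrA s); apply: Tst.
have KT : K `<=` T by move=> x Kx; apply/QT/JQ/ideal_addr.
have IT : I M `<=` T by move=> x Ix; apply/QT/JQ/ideal_addl.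
have NT : N `<=` T.
  have [m1 m1P] := Imul M.
  apply: (Ngen T (I M) (I m1)) => //; first by move=> x /(m1P _ (leqnn _)).
  by move=> sub; apply: unstable; exists m1 => m _ x /sub; apply: ideal_addr.
have [lT _] := tT.
have I0T : I n0 `<=` T.
  have sub : ideal_add (I M) (ideal_add N K) `<=` T.
    by do 2!apply: (ideal_add_sub) => //.
  move=> x /(n0P M) /=; rewrite (leq_trans (leq_maxr m0 n0) n1M) => /(_ isT).
  exact: sub.
apply: nIQ => x /(m0P _ (leq_maxl _ _)); apply: ideal_mul_sub => // a b Ia /I0T.
exact.
Qed.

End Stabilization.

(** * Rings noetherian over a central subset *)
Section NoetherianOverCenter.
Variables (S : pzRingType) (Z : set S).

Definition mul_ops : set (S -> S) := [set f | exists2 z, Z z & f = *%R z].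

(** The elements of [Z] serve as operators that commute with all multiplications,
so that left, right and two-sided ideals are closed under them alike. *)
Definition centrally_noetherian :=
  (forall z s, Z z -> z * s = s * z) /\ op_noetherian mul_ops.

Hypothesis SZ : centrally_noetherian.

Lemma left_ideal_op_closed X : left_ideal X -> op_closed mul_ops X.
Proof. by case=> X0 XB XM; split=> // _ x [z _ ->]; apply: XM. Qed.

Lemma right_closed_op_closed X : X 0 -> (forall x y, X x -> X y -> X (x - y)) ->
  (forall s x, X x -> X (x * s)) -> op_closed mul_ops X.
Proof.
by move=> X0 XB XM; split=> // _ x [z Zz ->] Xx; rewrite SZ.1 //; apply: XM.
Qed.

Lemma centrally_noetherian_max (F : set (set S)) : F !=set0 ->
    (forall X, F X -> left_ideal X) ->
  exists2 X, F X & forall Y, F Y -> X `<=` Y -> Y `<=` X.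
Proof.
move=> F0 FL; apply: (op_noetherian_max SZ.2) => // X /FL.
exact: left_ideal_op_closed.
Qed.

Lemma centrally_noetherian_acc : ideal_acc S.
Proof.
by move=> F F0 FT; apply: centrally_noetherian_max => // X /FT[].
Qed.

Lemma centrally_noetherian_determines :
  exists s : seq S, forall K, two_sided K -> determines K s.
Proof.
have [|s [_ sgen]] := SZ.2 setT; first by [].
exists s => K [lK KM] f mf Kf x; have [K0 KB KMl] := lK.
have f0 : f 0 = 0 by rewrite -(subrr 0) mulmap_sub // !subrr.
apply: (sgen [set x | K (f x)]) => //; split.
- by rewrite /= f0.
- by move=> y z Ky Kz /=; rewrite mulmap_sub //; apply: KB.
- move=> _ y [z Zz ->] Ky /=; have [l fl] := mf.
  suff -> : f (z * y) = z * f y by apply: KMl.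
  rewrite !fl mulr_sumr; apply: eq_bigr => t _.
  by rewrite !mulrA (SZ.1 z t.1 Zz).
Qed.

End NoetherianOverCenter.

Section EndomorphismsNoetherian.
Variables (R : comPzRingType) (M : lmodType R).

Definition scale_ops (N : lmodType R) : set (N -> N) :=
  [set f | exists r : R, f = *:%R r].

Lemma noetherian_regular : noetherian R -> op_noetherian (@scale_ops R^o).
Proof.
move=> noethR X [X0 XB XA]; pose J : {pred R} := fun x => `[<X x>].
have zJ : zmod_closed J.
  split; first exact/asboolP.
  by move=> x y /asboolP Xx /asboolP Xy; apply/asboolP; apply: XB.
have JM (s x : R) : x \in J -> s * x \in J.
  by move=> /asboolP Xx; apply/asboolP; apply: (XA (fun y => s * y)) => //; exists s.
have MJ (s x : R) : x \in J -> x * s \in J by rewrite mulrC; apply: JM.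
have [n [a aP]] := noethR (Ideal zJ JM MJ).
have aX i : X (a i).
  apply/asboolP/aP; exists (fun j => (j == i)%:R).
  rewrite (bigD1 i) //= eqxx mul1r big1 ?addr0 // => j /negPf->.
  by rewrite mul0r.
exists (codom a); split=> [_ /codomP[i ->]//|Y cY Ya x Xx].
have [c ->] := (aP x).1 (asboolT Xx).
apply: (@op_closed_sum R^o _ Y 'I_n _ xpredT (fun i => c i * a i) cY) => i _.
have [_ _ YA] := cY.
by apply: (YA (fun y => c i *: y)); [exists (c i)|apply: Ya; apply: codom_f].
Qed.

Hypothesis R_noetherian : noetherian R.
Hypothesis M_fin_gen : fin_gen M.

(** M is an image of a free module of finite rank. *)
Lemma fin_gen_noetherian : op_noetherian (@scale_ops M).
Proof.
have [n [g gP]] := M_fin_gen.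
pose h (c : 'I_n -> R^o) : M := \sum_(i < n) c i *: g i.
apply: (@op_noetherian_image _ _ [set f | exists r : R, f = *:%R r] _ h).
- apply: (op_noetherian_joint_kernel (n := n)
    (ev := fun i (c : 'I_n -> R^o) => if insub i is Some j then c j else 0)
    (noetherian_regular R_noetherian)).
  + by move=> i u v; case: insubP => [j _ _|_] //; rewrite subrr.
  + move=> i _ u [r ->]; case: insubP => [j _ _ u0|_ _] //.
    by change (r *: u j = 0); rewrite u0 scaler0.
  + move=> _ [r ->]; exists ( *:%R r); first by exists r.
    by move=> i u; case: insubP => [//|_]; rewrite scaler0.
  + move=> u u0; apply/funext => i; have := u0 i (ltn_ord i).
    by rewrite valK.
- move=> u v; rewrite /h -sumrB; apply: eq_bigr => i _; exact: scalerBl.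
- move=> _ [r ->]; exists ( *:%R r); first by exists r.
  move=> u; rewrite /h scaler_sumr; apply: eq_bigr => i _; rewrite scalerA //.
- move=> _ [r ->]; exists ( *:%R r); first by exists r.
  move=> u; rewrite /h scaler_sumr; apply: eq_bigr => i _; rewrite scalerA //.
- by move=> v; have [c ->] := gP v; exists c.
Qed.

Definition scaling (r : R) : endo M := GRing.scale r.

(** Evaluation at finitely many generators embeds End_R(M) in a power of M. *)
Lemma endo_centrally_noetherian : centrally_noetherian (range scaling).
Proof.
split=> [_ s [r _ <-]|]; first by apply: endoP => x /=; rewrite linearZ.
have [n [g gP]] := M_fin_gen.
apply: (op_noetherian_joint_kernel (n := n)
    (ev := fun i (f : endo M) => if insub i is Some j then f (g j) else 0)
    fin_gen_noetherian).
- by move=> i u v; case: insubP => [j _ _|_] //; rewrite subrr.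
- move=> i _ u [_ [r _ <-] ->]; case: insubP => [j _ _ u0|_ _] //.
  by change (r *: u (g j) = 0); rewrite u0 scaler0.
- move=> _ [r ->]; exists ( *%R (scaling r)).
    by exists (scaling r) => //; exists r.
  by move=> i u; case: insubP => [//|_]; rewrite scaler0.
- move=> u u0; apply: endoP => x; have [c ->] := gP x.
  rewrite linear_sum big1 // => i _; rewrite linearZ /=.
  by have := u0 i (ltn_ord i); rewrite valK => ->; rewrite scaler0.
Qed.

End EndomorphismsNoetherian.

(** * Locally finite families of linear maps and dual bases *)
Section FiniteSums.
Variable V : zmodType.

Lemma sum_eq_support (I : eqType) (F : I -> V) (s t : seq I) :
    uniq s -> uniq t -> (forall i, F i != 0 -> i \in s) ->
    (forall i, F i != 0 -> i \in t) ->
  \sum_(i <- s) F i = \sum_(i <- t) F i.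
Proof.
move=> us ut Fs Ft.
have nz r : \sum_(i <- r) F i = \sum_(i <- r | F i != 0) F i.
  rewrite (bigID (fun i => F i != 0)) /= [X in _ + X]big1 ?addr0 // => i.
  by rewrite negbK => /eqP.
rewrite nz [RHS]nz -!(big_filter _ (fun i => F i != 0)).
apply: perm_big; apply: uniq_perm; rewrite ?filter_uniq // => i.
by rewrite !mem_filter; case: (eqVneq (F i) 0) => //= /[dup] /Fs-> /Ft->.
Qed.

Lemma sum_ord_extend (F : nat -> V) (m n : nat) : (m <= n)%N ->
  (forall i, (m <= i)%N -> F i = 0) -> \sum_(i < n) F i = \sum_(i < m) F i.
Proof.
move=> mn F0; rewrite -(big_mkord xpredT F) (big_cat_nat (leq0n m) mn) /= big_mkord.
rewrite [X in _ + X]big_nat_cond [X in _ + X]big1 ?addr0 // => i.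
by case/andP=> /andP[mi _] _; apply: F0.
Qed.

End FiniteSums.

Section MakeLinear.
Variables (R : pzRingType) (A B : lmodType R) (f : A -> B).
Definition linear_fun of linear f := f.
Variable lf : linear f.
HB.instance Definition _ := GRing.isLinear.Build R A B *:%R (linear_fun lf) lf.
Definition mk_linear : {linear A -> B} := linear_fun lf.
End MakeLinear.

Section LinearMaps.
Variable R : pzRingType.
Implicit Types A B V N P Q : lmodType R.

Lemma linear_ex A B (f : A -> B) : linear f -> exists F : {linear A -> B}, F =1 f.
Proof. by move=> lf; exists (mk_linear lf). Qed.

(** The sum is independent of the bound at which it is cut off, which is what
makes it linear. *)
Lemma locally_finite_sum A B (h : nat -> {linear A -> B}) :
    (forall x, exists n, forall i, (n <= i)%N -> h i x = 0) ->
  exists H : {linear A -> B}, forall x n,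
    (forall i, (n <= i)%N -> h i x = 0) -> H x = \sum_(i < n) h i x.
Proof.
move=> /choice[d dP]; pose f x := \sum_(i < d x) h i x.
have fE x n : (forall i, (n <= i)%N -> h i x = 0) -> f x = \sum_(i < n) h i x.
  move=> hn; rewrite /f -(sum_ord_extend (leq_maxl (d x) n) (dP x)).
  by rewrite -(sum_ord_extend (leq_maxr (d x) n) hn).
have lf : linear f.
  move=> a x y; pose n := maxn (d x) (d y).
  have hx i : (n <= i)%N -> h i x = 0.
    by rewrite geq_max => /andP[+ _]; apply: dP.
  have hy i : (n <= i)%N -> h i y = 0.
    by rewrite geq_max => /andP[_]; apply: dP.
  rewrite (fE x n hx) (fE y n hy) (fE _ n) ?scaler_sumr -?big_split /=.
    by apply: eq_bigr => i _; rewrite linearP.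
  by move=> i ni; rewrite linearP hx // hy // scaler0 addr0.
by exists (mk_linear lf) => x n; apply: fE.
Qed.

Definition submod_set A (X : set A) :=
  X 0 /\ forall (a : R) x y, X x -> X y -> X (a *: x + y).

Lemma submod_set_sum A (X : set A) (I : Type) (r : seq I) (P : pred I) (F : I -> A) :
  submod_set X -> (forall i, P i -> X (F i)) -> X (\sum_(i <- r | P i) F i).
Proof.
move=> [X0 XD] XF; apply: (big_ind X) => // x y Xx Xy.
by rewrite -[x]scale1r; apply: XD.
Qed.

Lemma submod_setZ A (X : set A) a x : submod_set X -> X x -> X (a *: x).
Proof. by move=> [X0 XD] Xx; rewrite -[_ *: _]addr0; apply: XD. Qed.

Definition generates A (I : Type) (g : I -> A) :=
  forall X : set A, submod_set X -> (forall i, X (g i)) -> forall x, X x.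

Lemma count_gen_generates A (I : countType) (g : I -> A) :
  generates g -> count_gen A.
Proof.
move=> gen; pose g' (k : nat) := if unpickle k is Some i then g i else 0.
exists g'; have := gen [set x | exists n (c : nat -> R), x = \sum_(i < n) c i *: g' i].
apply.
  split; first by exists 0%N, (fun=> 0); rewrite big_ord0.
  move=> a x y [m [c ->]] [n [d ->]].
  pose cut (k : nat) (e : nat -> R) i := if (i < k)%N then e i else 0.
  exists (maxn m n), (fun i => a * cut m c i + cut n d i).
  have cutE k (e : nat -> R) : (k <= maxn m n)%N ->
      \sum_(i < k) e i *: g' i = \sum_(i < maxn m n) cut k e i *: g' i.
    move=> kmn; rewrite (sum_ord_extend kmn (F := fun i => cut k e i *: g' i)).
      by apply: eq_bigr => i _; rewrite /cut ltn_ord.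
    by move=> i; rewrite /cut ltnNge => ->; rewrite scale0r.
  rewrite (cutE m) ?leq_maxl // (cutE n) ?leq_maxr // scaler_sumr -big_split.
  by apply: eq_bigr => i _; rewrite scalerDl scalerA.
move=> i; exists (pickle i).+1, (fun k => (k == pickle i)%:R).
rewrite big_ord_recr /= eqxx /g' pickleK scale1r big1 ?add0r // => k _.
by rewrite ltn_eqF ?scale0r.
Qed.

Lemma count_genP A : count_gen A <-> exists g : nat -> A, generates g.
Proof.
split=> [[g gP]|[g]]; last exact: count_gen_generates.
exists g => X sX Xg x; have [n [c ->]] := gP x.
by apply: submod_set_sum => // i _; apply: submod_setZ.
Qed.

Lemma hom_image_count_gen A B : hom_image A B -> count_gen A -> count_gen B.
Proof.
move=> [f fsurj] [g gP]; exists (f \o g) => y; have [x <-] := fsurj y.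
have [n [c ->]] := gP x; exists n, c; rewrite linear_sum.
by apply: eq_bigr => i _; rewrite linearZ.
Qed.

(** A dual basis with values in V presents N as a retract of a sum of countably
many copies of V.  For V = R this is a dual basis of a projective module; the
modules in V*(M) have one for V = M. *)
Definition dual_basis V N (b : nat -> {linear V -> N}) (phi : nat -> {linear N -> V}) :=
  forall x, exists n, (forall i, (n <= i)%N -> phi i x = 0) /\
    x = \sum_(i < n) b i (phi i x).

Lemma dual_basisE V N b phi x n : @dual_basis V N b phi ->
  (forall i, (n <= i)%N -> phi i x = 0) -> x = \sum_(i < n) b i (phi i x).
Proof.
move=> bphi phin; have [m [phim xE]] := bphi x; rewrite {1}xE.
rewrite -(sum_ord_extend (leq_maxl m n) (F := fun i => b i (phi i x))).
  rewrite -(sum_ord_extend (leq_maxr m n) (F := fun i => b i (phi i x))) //.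
  by move=> i /phin->; rewrite linear0.
by move=> i /phim->; rewrite linear0.
Qed.

(** A countably generated module in which every single element is fixed by an
endomorphism factoring through a finite power of V is a retract of a
sum of countably many copies of V.  Enumerate generators g_n and define r_0 = id and
r_(n+1) = (1 - e_n) r_n, where e_n factors through a finite power and fixes
r_n(g_n).  Then r_n(x) vanishes for n large, and x is the sum of the
e_n(r_n(x)). *)
Theorem locally_retract_dual_basis V N : count_gen N ->
    (forall x : N, exists l : seq ({linear V -> N} * {linear N -> V}),
      x = \sum_(t <- l) t.1 (t.2 x)) ->
  exists b phi, @dual_basis V N b phi.
Proof.
move=> [g gP] /choice[E EP].
have /choice[res resP] : forall p : seq ({linear V -> N} * {linear N -> V}) *
    {linear N -> N}, exists r : {linear N -> N},
    forall x, r x = p.2 x - \sum_(t <- p.1) t.1 (t.2 (p.2 x)).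
  move=> [l f] /=; apply: linear_ex => a x y.
  rewrite linearP scalerBr scaler_sumr addrACA -opprD -big_split /=.
  by congr (_ - _); apply: eq_bigr => t _; rewrite !linearP.
pose r := fix r (n : nat) : {linear N -> N} :=
  if n is m.+1 then res (E (r m (g m)), r m) else idfun.
pose l n := E (r n (g n)).
have rS n x : r n.+1 x = r n x - \sum_(t <- l n) t.1 (t.2 (r n x)) by rewrite /= resP.
have rg n : r n.+1 (g n) = 0 by rewrite rS -EP subrr.
have r_stable n m x : (n <= m)%N -> r n x = 0 -> r m x = 0.
  move=> nm rn0; elim: m nm => [|m IHm]; first by rewrite leqn0 => /eqP<-.
  rewrite leq_eqVlt => /predU1P[<-//|/IHm rm0].
  by rewrite rS rm0 big1 ?subr0 // => t _; rewrite !linear0.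
have r_ev x : exists n, r n x = 0.
  have [n [c ->]] := gP x; exists n; rewrite linear_sum big1 // => i _.
  by rewrite linearZ /= (r_stable i.+1 n) ?scaler0.
have r_sum n x : x - r n x = \sum_(m < n) \sum_(t <- l m) t.1 (t.2 (r m x)).
  elim: n => [|n IHn]; first by rewrite big_ord0 subrr.
  by rewrite big_ord_recr -IHn rS /= opprB addrA addrAC.
(* The pairs occurring in the e_n, indexed by (n, j), are listed along an
   injection of nat * nat into nat and padded by zero maps. *)
pose d := (\0 : {linear V -> N}, \0 : {linear N -> V}).
pose b k : {linear V -> N} :=
  if pickle_inv k is Some p then (nth d (l p.1) p.2).1 else \0.
pose phi k : {linear N -> V} :=
  if pickle_inv k is Some p then (nth d (l p.1) p.2).2 \o r p.1 else \0.
exists b, phi => x; have [n rn0] := r_ev x.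
pose s := [seq (m, j) | m <- iota 0 n, j <- iota 0 (size (l m))].
have us : uniq s.
  apply: allpairs_uniq_dep => [|m _|]; try exact: iota_uniq.
  by move=> [m j] [m' j'] _ _ /= [-> ->].
have phi0 p : p \notin s -> phi (pickle p) x = 0.
  case: p => m j ps; rewrite /phi pickleK_inv /=.
  have [nm|mn] := leqP n m; first by rewrite (r_stable _ _ _ nm rn0) linear0.
  have [lj|jl] := leqP (size (l m)) j; first by rewrite nth_default.
  case/negP: ps; apply/allpairsPdep; exists m, j.
  by rewrite !mem_iota !add0n /= mn jl.
pose k := (\max_(p <- s) pickle p).+1; exists k.
have phik i : (k <= i)%N -> phi i x = 0.
  rewrite /phi; case Ei: (pickle_inv i) => [p|//] ki.
  have Ep : pickle p = i by have := pickle_invK (T := (nat * nat)%type) i; rewrite Ei.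
  have := phi0 p; rewrite /phi pickleK_inv; apply; apply/negP => ps.
  move: ki; rewrite -Ep /k leqNgt => /negP; apply; rewrite ltnS.
  exact: leq_bigmax_seq.
split=> //; have := r_sum n x; rewrite rn0 subr0 => xE; rewrite [LHS]xE {xE}.
pose F i := b i (phi i x).
have F0 i : F i != 0 -> phi i x != 0.
  by apply: contraNneq => phi0'; rewrite /F phi0' linear0.
have -> : \sum_(i < k) b i (phi i x) = \sum_(i <- map pickle s) F i.
  rewrite -(big_mkord xpredT F) /index_iota subn0; apply: sum_eq_support.
  - exact: iota_uniq.
  - by rewrite map_inj_uniq //; apply: pcan_inj pickleK.
  - move=> i /F0; rewrite mem_iota add0n /=; apply: contraR; rewrite -leqNgt.
    by move=> /phik->.
  - move=> i /F0 Fi; have : phi i x != 0 by [].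
    rewrite /phi; case Ei: (pickle_inv i) => [p|]; last by rewrite eqxx.
    have Ep : pickle p = i by have := pickle_invK (T := (nat * nat)%type) i; rewrite Ei.
    move=> _; rewrite -Ep map_f //; apply: contraR Fi => /phi0.
    by rewrite Ep => ->.
rewrite big_map big_allpairs_dep /= -(big_mkord xpredT (fun m =>
  \sum_(t <- l m) t.1 (t.2 (r m x)))) /index_iota subn0.
apply: eq_bigr => m _; rewrite (big_nth d) /index_iota subn0.
by apply: eq_bigr => j _; rewrite /F /b /phi pickleK_inv.
Qed.

End LinearMaps.

(** * Direct sums, summands and projective modules *)
Section Submodule.
Variables (R : pzRingType) (V : lmodType R) (X : set V) (sX : submod_set X).

Definition submodule_pred of submod_set X : {pred V} := fun x => `[<X x>].

Lemma submodule_closed : submod_closed (submodule_pred sX).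
Proof.
split; first by apply/asboolP; case: sX.
by move=> a x y /asboolP Xx /asboolP Xy; apply/asboolP; case: sX => _; apply.
Qed.

HB.instance Definition _ :=
  GRing.isSubmodClosed.Build R V (submodule_pred sX) submodule_closed.

Record submodule := Submodule {
  submodule_val :> V; submodule_mem : submodule_val \in submodule_pred sX }.

HB.instance Definition _ := [isSub for submodule_val].
HB.instance Definition _ := [Choice of submodule by <:].
HB.instance Definition _ := [SubChoice_isSubLmodule of submodule by <:].

Lemma submodule_in (x : submodule) : X x.
Proof. by case: x => x /= /asboolP. Qed.

Definition to_submodule x (Xx : X x) : submodule := Submodule (asboolT Xx).

End Submodule.

Section DirectSums.
Variable R : pzRingType.
Implicit Types A B V N P Q : lmodType R.

Lemma dsumP X V (x y : dsum X V) : dsum_fun x =1 dsum_fun y -> x = y.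
Proof. by move=> xy; apply: val_inj; apply/funext. Qed.

Lemma dsum_coord_linear X V (a : X) : linear (fun x : dsum X V => x a).
Proof. by []. Qed.

Lemma dsum_delta_linear X V (a : X) : linear (@delta R X V a).
Proof.
move=> c x y; apply: dsumP => b; rewrite /delta /=.
change ((if `[< b = a >] then c *: x + y else 0) =
  c *: (if `[< b = a >] then x else 0) + (if `[< b = a >] then y else 0)).
by case: ifP => // _; rewrite scaler0 addr0.
Qed.

Definition dsum_coord X V (a : X) := mk_linear (@dsum_coord_linear X V a).
Definition dsum_delta X V (a : X) := mk_linear (@dsum_delta_linear X V a).

Lemma dsum_deltaE X V (a b : X) (v : V) :
  dsum_delta V a v b = if `[< b = a >] then v else 0.
Proof. by []. Qed.

Lemma dsum_supportP (X : choiceType) V (x : dsum X V) : exists s : seq X,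
  [/\ uniq s, forall a, (a \in s) = (x a != 0) &
      x = \sum_(a <- s) dsum_delta V a (x a)].
Proof.
have /asboolP/finite_seqP[s sE] := dsum_finsupp x.
have memE a : (a \in undup s) = (x a != 0).
  rewrite mem_undup; apply/idP/idP => [sa|/eqP xa].
    by apply/eqP; have : [set` s] a by []; rewrite -sE.
  by suff : [set` s] a by []; rewrite -sE.
exists (undup s); split=> //; first exact: undup_uniq.
apply: dsumP => b.
change (x b = dsum_coord V b (\sum_(a <- undup s) dsum_delta V a (x a))).
rewrite linear_sum; have [bs|bs] := boolP (b \in undup s).
  rewrite (bigD1_seq b) ?undup_uniq //= big1 ?addr0 => [|a ab].
    by change (x b = dsum_delta V b (x b) b); rewrite dsum_deltaE; case: asboolP.
  change (dsum_delta V a (x a) b = 0); rewrite dsum_deltaE.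
  by case: asboolP => // ba; rewrite ba eqxx in ab.
rewrite big_seq big1 => [|a as_]; first by apply/eqP; rewrite memE negbK in bs.
change (dsum_delta V a (x a) b = 0); rewrite dsum_deltaE.
by case: asboolP => // ba; rewrite ba as_ in bs.
Qed.

Lemma dsum_nat_bound V (x : dsum nat V) : exists n, forall i, (n <= i)%N -> x i = 0.
Proof.
have [s [_ sx _]] := dsum_supportP x.
exists (\max_(i <- s) i).+1 => i; rewrite ltnNge => /negP im.
apply/eqP; apply: contraT; rewrite -sx => si; case: im.
by apply: (leq_bigmax_seq (F := id)).
Qed.

Lemma cancel_isomorphic A B (f : {linear A -> B}) (g : B -> A) :
  cancel f g -> cancel g f -> isomorphic A B.
Proof. by move=> fg gf; exists f; exists g. Qed.

Lemma isomorphic_refl A : isomorphic A A.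
Proof. by apply: (@cancel_isomorphic A A idfun id). Qed.

Lemma isomorphic_inv A B : isomorphic A B -> exists (f : {linear A -> B})
  (g : {linear B -> A}), cancel f g /\ cancel g f.
Proof.
move=> [f [g fg gf]]; exists f.
have lg : linear g.
  by move=> c x y; apply: (can_inj fg); rewrite linearP !gf.
by exists (mk_linear lg).
Qed.

Lemma isomorphic_sym A B : isomorphic A B -> isomorphic B A.
Proof. by move=> /isomorphic_inv[f [g [fg gf]]]; apply: (cancel_isomorphic gf fg). Qed.

(** The complement is the kernel of the retraction. *)
Lemma retract_summand N B (i : {linear N -> B}) (p : {linear B -> N}) :
  cancel i p -> is_summand N B.
Proof.
move=> ip; have sK : submod_set [set x | p x = 0].
  split; first exact: linear0.
  by move=> a x y px py /=; rewrite linearP px py scaler0 addr0.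
have kerP x : [set x | p x = 0] (x - i (p x)) by rewrite /= linearB ip subrr.
exists (submodule sK).
have lf : linear (fun u : N * submodule sK => i u.1 + submodule_val u.2).
  move=> a u v; rewrite linearP scalerDr addrACA; congr (_ + _).
apply: (@cancel_isomorphic _ _ (mk_linear lf) (fun x => (p x, to_submodule sK (kerP x)))).
- move=> [x k] /=; pose y := submodule_val (k : submodule sK).
  have pk : p y = 0 := submodule_in (k : submodule sK).
  have px : p (i x + y) = x by rewrite linearD ip pk addr0.
  change ((p (i x + y), to_submodule sK (kerP (i x + y))) = (x, k)).
  congr (_, _); first exact: px.
  apply: val_inj.
  by change (i x + y - i (p (i x + y)) = y); rewrite px addrC addKr.
- by move=> x; change (i (p x) + (x - i (p x)) = x); rewrite addrC subrK.
Qed.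

Lemma summand_retract N B : is_summand N B ->
  exists (i : {linear N -> B}) (p : {linear B -> N}), cancel i p.
Proof.
move=> [C /isomorphic_inv[f [g [fg gf]]]].
have li : linear (fun x : N => f (x, 0)).
  move=> a x y; rewrite -linearP; congr (f (_, _)).
  by change (0 = a *: 0 + 0 :> C); rewrite scaler0 addr0.
have lp : linear (fun y => (g y).1) by move=> a x y; rewrite linearP.
exists (mk_linear li), (mk_linear lp) => x.
by change ((g (f (x, 0))).1 = x); rewrite fg.
Qed.

Lemma dual_basis_summand V N b phi :
  @dual_basis R V N b phi -> is_summand N (dsum nat V).
Proof.
move=> bphi.
have phi_fin x : (fun i => phi i x) \in @finsupp R nat V.
  apply/asboolP; have [n [phin _]] := bphi x.
  apply: (@sub_finite_set _ _ `I_n) => // i /= phix.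
  by rewrite ltnNge; apply/negP => /phin.
have li : linear (fun x => DSum (phi_fin x)).
  by move=> a x y; apply: dsumP => i /=; rewrite linearP.
have [|p pP] := @locally_finite_sum R (dsum nat V) N
  (fun i => b i \o dsum_coord V i).
  move=> x; have [n xn] := dsum_nat_bound x; exists n => i ni /=.
  by change (b i (x i) = 0); rewrite xn // linear0.
apply: (@retract_summand _ _ (mk_linear li) p) => x.
have [n [phin xE]] := bphi x; rewrite (pP _ n) => [|i ni]; first by [].
by change (b i (phi i x) = 0); rewrite phin // linear0.
Qed.

(** Each element has finite support in the sum of X copies of V, so it is fixed
by an endomorphism through a finite power of V, whatever the size of X. *)
Lemma summand_dual_basis X V N : count_gen N -> is_summand N (dsum X V) ->
  exists b phi, @dual_basis R V N b phi.
Proof.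
elim/Pchoice: X => X cN /summand_retract[i [p ip]].
apply: locally_retract_dual_basis => // x.
have [s [_ _ ixE]] := dsum_supportP (i x).
exists [seq (p \o dsum_delta V a : {linear V -> N},
             dsum_coord V a \o i : {linear N -> V}) | a <- s].
by rewrite big_map -[LHS]ip {1}ixE linear_sum.
Qed.

Lemma locally_generated_dual_basis P : count_gen P ->
    (forall x : P, exists l : seq (P * {linear P -> R^o}),
      x = \sum_(t <- l) (t.2 x : R) *: t.1) ->
  exists b phi, @dual_basis R R^o P b phi.
Proof.
move=> cP loc; apply: locally_retract_dual_basis => // x; have [l xE] := loc x.
have lb (y : P) : linear (fun r : R^o => (r : R) *: y).
  by move=> a r s; rewrite scalerA -scalerDl.
exists [seq (mk_linear (lb t.1), t.2) | t <- l].
by rewrite big_map {1}xE.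
Qed.

(** A [dual_basis] for V = R, where maps R -> P are given by elements of P. *)
Definition element_basis P (b : nat -> P) (phi : nat -> {linear P -> R^o}) :=
  forall x, exists n, (forall i, (n <= i)%N -> phi i x = 0) /\
    x = \sum_(i < n) (phi i x : R) *: b i.

Lemma element_basisE P b phi x n : @element_basis P b phi ->
  (forall i, (n <= i)%N -> phi i x = 0) -> x = \sum_(i < n) (phi i x : R) *: b i.
Proof.
move=> bphi phin; have [m [phim xE]] := bphi x; rewrite {1}xE.
rewrite -(sum_ord_extend (leq_maxl m n) (F := fun i => (phi i x : R) *: b i)).
  rewrite -(sum_ord_extend (leq_maxr m n) (F := fun i => (phi i x : R) *: b i)) //.
  by move=> i /phin->; rewrite scale0r.
by move=> i /phim->; rewrite scale0r.
Qed.

Lemma dual_element_basis P b phi : @dual_basis R R^o P b phi ->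
  element_basis (fun i => b i 1) phi.
Proof.
move=> bphi x; have [n [phin xE]] := bphi x; exists n; split=> //.
rewrite {1}xE; apply: eq_bigr => i _; rewrite -linearZ; congr (b i _).
by rewrite /GRing.scale /= mulr1.
Qed.

Lemma element_basis_count_gen P b phi : @element_basis P b phi -> count_gen P.
Proof.
move=> bphi; apply/count_genP; exists b => X sX Xb x.
have [n [_ ->]] := bphi x; apply: submod_set_sum => // i _.
exact: submod_setZ.
Qed.

Lemma element_basis_projective P b phi : @element_basis P b phi -> projective P.
Proof.
move=> bphi A B f g fsurj.
have /choice[a aP] : forall i, exists a, f a = g (b i) by move=> i; apply: fsurj.
have lh i : linear (fun x => (phi i x : R) *: a i).
  by move=> c x y; rewrite linearP scalerDl scalerA.
have hE i x : mk_linear (lh i) x = (phi i x : R) *: a i by [].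
have [|h hP] := @locally_finite_sum R P A (fun i => mk_linear (lh i)).
  move=> x; have [n [phin _]] := bphi x; exists n => i /phin phi0.
  by rewrite hE phi0 scale0r.
exists h => x; have [n [phin xE]] := bphi x.
rewrite (hP x n) => [|i /phin phi0]; last by rewrite hE phi0 scale0r.
rewrite [in RHS]xE !linear_sum; apply: eq_bigr => i _.
by rewrite hE !linearZ /= aP.
Qed.

Lemma projective_element_basis P : count_gen P -> projective P ->
  exists b phi, @element_basis P b phi.
Proof.
move=> [g gP] pP.
have lh i : linear (fun x : dsum nat R^o => (x i : R) *: g i).
  by move=> c x y; rewrite scalerA -scalerDl.
have [|f fP] := @locally_finite_sum R (dsum nat R^o) P (fun i => mk_linear (lh i)).
  move=> x; have [n xn] := dsum_nat_bound x; exists n => i ni.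
  by change ((x i : R) *: g i = 0); rewrite xn // scale0r.
have [|s sP] := pP _ _ f idfun.
  move=> y; have [n [c yE]] := gP y.
  exists (\sum_(i < n) dsum_delta R^o (i : nat) (c i)).
  rewrite linear_sum yE; apply: eq_bigr => i _.
  rewrite (fP _ i.+1) => [|j ij]; last first.
    change ((dsum_delta R^o (i : nat) (c i) j : R) *: g j = 0).
    rewrite dsum_deltaE; case: asboolP => [ji|_]; last by rewrite scale0r.
    by rewrite ji ltnn in ij.
  rewrite big_ord_recr big1 => [|j _].
    change (0 + (dsum_delta R^o (i : nat) (c i) i : R) *: g i = c i *: g i).
    by rewrite add0r dsum_deltaE; case: asboolP.
  change ((dsum_delta R^o (i : nat) (c i) j : R) *: g j = 0).
  rewrite dsum_deltaE; case: asboolP => [ji|_]; rewrite ?scale0r //.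
  by have := ltn_ord j; rewrite ji ltnn.
exists g, (fun i => dsum_coord R^o i \o s) => x.
have [n xn] := dsum_nat_bound (s x); exists n; split=> //.
rewrite -[LHS]sP (fP _ n) // => i ni.
by change ((s x i : R) *: g i = 0); rewrite xn // scale0r.
Qed.

Lemma dsum_nat_projective P : projective P -> projective (dsum nat P).
Proof.
move=> pP A B f g fsurj.
have /choice[h hP] : forall i, exists h : {linear P -> A},
    forall x, f (h x) = g (dsum_delta P i x).
  by move=> i; apply: (pP _ _ f (g \o dsum_delta P i)).
have h0 (x : dsum nat P) n : (forall i, (n <= i)%N -> x i = 0) ->
    forall i, (n <= i)%N -> (h i \o dsum_coord P i) x = 0.
  by move=> xn i ni; change (h i (x i) = 0); rewrite xn // linear0.
have [|H HP] := @locally_finite_sum R (dsum nat P) A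
    (fun i => h i \o dsum_coord P i).
  by move=> x; have [n xn] := dsum_nat_bound x; exists n; apply: h0.
exists H => x; have [n xn] := dsum_nat_bound x.
rewrite (HP x n); last exact: h0.
rewrite linear_sum (eq_bigr (fun i : 'I_n => g (dsum_delta P (i : nat) (x i)))).
  rewrite -linear_sum; congr (g _); apply: dsumP => j.
  change (dsum_coord P j (\sum_(i < n) dsum_delta P (i : nat) (x i)) = x j).
  rewrite linear_sum; have [jn|nj] := ltnP j n; last first.
    rewrite xn // big1 // => i _.
    change (dsum_delta P (i : nat) (x i) j = 0); rewrite dsum_deltaE.
    by case: asboolP => // ji; have := ltn_ord i; rewrite -ji ltnNge nj.
  rewrite (bigD1 (Ordinal jn)) //= big1 ?addr0 => [|i ij].
    by change (dsum_delta P j (x j) j = x j); rewrite dsum_deltaE; case: asboolP.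
  change (dsum_delta P (i : nat) (x i) j = 0); rewrite dsum_deltaE.
  case: asboolP => // ji; case/eqP: ij; exact/val_inj.
by move=> i _; rewrite -hP.
Qed.

Lemma dsum_generates (X : choiceType) V (F : set (dsum X V)) : submod_set F ->
  (forall a v, F (dsum_delta V a v)) -> forall x, F x.
Proof.
move=> sF FX x; have [s [_ _ ->]] := dsum_supportP x.
by apply: submod_set_sum.
Qed.

Lemma dsum_count_gen (X : countType) P : count_gen P -> count_gen (dsum X P).
Proof.
move=> /count_genP[g gP].
apply: (@count_gen_generates _ _ (X * nat)%type (fun t => dsum_delta P t.1 (g t.2))).
move=> F sF Fg; apply: dsum_generates => // a.
have := gP [set v | F (dsum_delta P a v)]; apply=> [|i]; last exact: (Fg (a, i)).
split; first by rewrite /= linear0; case: sF.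
by move=> c x y Fx Fy /=; rewrite linearP; case: sF => _; apply.
Qed.

Lemma fin_gen_count_gen A : fin_gen A -> count_gen A.
Proof.
move=> [n [g gP]]; apply: (@count_gen_generates _ _ 'I_n g) => F sF Fg x.
by have [c ->] := gP x; apply: submod_set_sum => // i _; apply: submod_setZ.
Qed.

End DirectSums.

(** * Idempotent ideals are traces *)

(** Let I = S x_1 + ... + S x_k be an idempotent ideal.  Consider the direct limit
of a sequence of copies of the free right module on the words in k letters, along
the maps that send the word w to the sum of the words i :: w times x_i.  A functional on the limit
is a compatible family of functions on words, called a thread.  Idempotency
allows one to divide elements of I by the x_i with quotients in I, so that threads
with prescribed values in I exist.  The module used is the image of the limit
in the functions on threads; it has enough functionals by construction, which
makes it projective by [locally_generated_dual_basis]. *)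
Section IdempotentIdealTrace.
Variables (S : pzRingType) (I : set S) (k : nat) (x : 'I_k -> S).
Hypothesis tI : two_sided I.
Hypothesis xI : forall i, I (x i).
Hypothesis I_div : forall h, I h ->
  exists2 d : 'I_k -> S, (forall i, I (d i)) & h = \sum_(i < k) d i * x i.

Local Notation W := (seq 'I_k).

Definition parent_sum (h : W -> S) (w : W) := \sum_(i < k) h (i :: w) * x i.

Definition thread := {l : nat -> W -> S | forall n, l n = parent_sum (l n.+1)}.

(** Below level m the values are forced; above it they are found by dividing by
the x_i again and again. *)
Lemma thread_through (m : nat) (h : W -> S) : (forall w, I (h w)) ->
  exists l : thread, sval l m = h.
Proof.
move=> hI.
have /choice[d dP] : forall a, exists d : 'I_k -> S,
    I a -> (forall i, I (d i)) /\ a = \sum_(i < k) d i * x i.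
  move=> a; have [/I_div[d dI aE]|nI] := pselect (I a); last by exists (fun=> 0).
  by exists d.
pose up (h : W -> S) (w : W) := if w is i :: w' then d (h w') i else 0.
have upI n w : I (iter n up h w).
  elim: n w => [|n IHn] w; first exact: hI.
  case: w => [|i w] /=; first by case: tI => [[]].
  by have [dI _] := dP _ (IHn w); apply: dI.
pose l n := if (n <= m)%N then iter (m - n) parent_sum h else iter (n - m) up h.
have lP n : l n = parent_sum (l n.+1).
  rewrite /l; have [nm|mn] := ltnP n m.
    by rewrite (ltnW nm) -(subnSK nm).
  have -> : (if (n <= m)%N then iter (m - n) parent_sum h else iter (n - m) up h) =
      iter (n - m) up h.
    case: leqP => // nm; have -> : n = m by apply/eqP; rewrite eqn_leq nm.
    by rewrite subnn.
  rewrite subSn //=; apply/funext => w; rewrite /parent_sum /=.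
  by have [] := dP _ (upI (n - m)%N w).
by exists (exist _ l lP); rewrite /= /l leqnn subnn.
Qed.

Local Notation F := (thread -> (S^c)^o).

Definition eval_at (m : nat) (w : W) : F := fun l => sval l m w.

Lemma eval_thread_linear (l : thread) : linear (fun f : F => f l).
Proof. by []. Qed.

Lemma eval_atE m w :
  eval_at m w = \sum_(i < k) (x i : S^c) *: eval_at m.+1 (i :: w).
Proof.
apply/funext => l.
change (eval_at m w l = mk_linear (eval_thread_linear l)
  (\sum_(i < k) (x i : S^c) *: eval_at m.+1 (i :: w))).
by rewrite linear_sum /= /eval_at (svalP l m).
Qed.

Definition eval_span : set F := [set f | forall Y : set F, submod_set Y ->
  (forall m w, Y (eval_at m w)) -> Y f].

Lemma eval_span_submod : submod_set eval_span.
Proof.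
split=> [Y []//|a f g Yf Yg Y sY Yev]; have [_ YD] := sY.
by apply: YD; [apply: Yf|apply: Yg].
Qed.

Definition thread_module : lmodType S^c := submodule eval_span_submod.
Local Notation Q := thread_module.

Lemma eval_span_gen m w : eval_span (eval_at m w).
Proof. by move=> Y _; apply. Qed.

Definition node m w : Q := to_submodule eval_span_submod (eval_span_gen m w).

Lemma thread_module_ind (Y : set Q) : submod_set Y ->
  (forall m w, Y (node m w)) -> forall q, Y q.
Proof.
move=> [Y0 YD] Yn q; have qF := submodule_in (q : submodule eval_span_submod).
have := qF [set f | exists2 p : Q, Y p &
  submodule_val (p : submodule eval_span_submod) = f].
case=> [||p Yp pq].
- split; first by exists 0.
  by move=> a _ _ [p Yp <-] [p' Yp' <-]; exists (a *: p + p') => //; apply: YD.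
- by move=> m w; exists (node m w).
- by rewrite (_ : q = p) //; apply: val_inj.
Qed.

Lemma nodeE m w : node m w = \sum_(i < k) (x i : S^c) *: node m.+1 (i :: w).
Proof.
have lv : linear (submodule_val (sX := eval_span_submod)) by [].
apply: val_inj.
change (eval_at m w = mk_linear lv (\sum_(i < k) (x i : S^c) *: node m.+1 (i :: w))).
by rewrite linear_sum eval_atE.
Qed.

Lemma thread_module_count_gen : count_gen Q.
Proof.
apply: (@count_gen_generates _ _ (nat * W)%type (fun t => node t.1 t.2)).
by move=> Y sY Yn; apply: thread_module_ind => // m w; apply: (Yn (m, w)).
Qed.

Lemma thread_coord_linear (l : thread) : linear (fun q : Q =>
  submodule_val (q : submodule eval_span_submod) l : (S^c)^o).
Proof. by []. Qed.

Definition thread_coord l : {linear Q -> (S^c)^o} := mk_linear (thread_coord_linear l).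

Lemma thread_coordE l m w : thread_coord l (node m w) = sval l m w.
Proof. exact: erefl. Qed.

(** By [nodeE] an element can be pushed to all higher levels, so that finitely
many elements live on a common one. *)
Lemma thread_module_level (q : Q) : exists m, forall m', (m <= m')%N ->
  exists l : seq (W * S^c), q = \sum_(t <- l) t.2 *: node m' t.1.
Proof.
apply: (thread_module_ind (Y := [set q | exists m, forall m', (m <= m')%N ->
  exists l : seq (W * S^c), q = \sum_(t <- l) t.2 *: node m' t.1])).
  split; first by exists 0%N => m' _; exists [::]; rewrite big_nil.
  move=> a p p' [m pm] [m' pm']; exists (maxn m m') => n.
  rewrite geq_max => /andP[/pm[l ->] /pm'[l' ->]].
  exists ([seq (t.1, a * t.2) | t <- l] ++ l').
  rewrite big_cat big_map scaler_sumr /=; congr (_ + _).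
  by apply: eq_bigr => t _; rewrite scalerA.
move=> m w; exists m => m' /subnK <-.
elim: (m' - m)%N => [|n [l lE]].
  by exists [:: (w, 1)]; rewrite big_seq1 scale1r.
exists [seq (i :: t.1, t.2 * (x i : S^c)) | t <- l, i <- index_enum 'I_k].
rewrite big_allpairs_dep lE; apply: eq_bigr => t _.
by rewrite nodeE scaler_sumr; apply: eq_bigr => i _; rewrite scalerA.
Qed.

(** The node w at level m is the sum of the nodes i :: w times x_i, and x_i is
the value at node w of a functional that vanishes at the other nodes of
level m.  So q is a combination of nodes with values of functionals at q. *)
Lemma thread_module_projective : projective Q.
Proof.
have [b [phi bphi]] : exists b phi, @dual_basis S^c (S^c)^o Q b phi; last first.
  exact: element_basis_projective (dual_element_basis bphi).
apply: locally_generated_dual_basis => [|q]; first exact: thread_module_count_gen.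
have [m /(_ _ (leqnn m))[l qE]] := thread_module_level q.
have /choice[th thP] : forall p : W * 'I_k, exists t : thread,
    sval t m = fun w => if w == p.1 then x p.2 else 0.
  move=> [w i] /=; apply: thread_through => w'; case: ifP => _; first exact: xI.
  by case: tI => [[]].
pose s := undup (map fst l).
exists [seq (node m.+1 (i :: w), thread_coord (th (w, i)))
  | w <- s, i <- index_enum 'I_k].
rewrite big_allpairs_dep /=.
pose e (q : Q) := \sum_(w <- s) \sum_(i <- index_enum 'I_k)
  (thread_coord (th (w, i)) q : S^c) *: node m.+1 (i :: w).
have le : linear e.
  move=> a p p'; rewrite /e scaler_sumr -big_split; apply: eq_bigr => w _.
  rewrite scaler_sumr -big_split; apply: eq_bigr => i _.
  by rewrite linearP scalerDl scalerA.
change (q = mk_linear le q); rewrite qE linear_sum big_seq [RHS]big_seq.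
apply: eq_bigr => t tl; rewrite linearZ; congr (_ *: _).
change (node m t.1 = e (node m t.1)); rewrite /e.
rewrite (bigD1_seq t.1) ?undup_uniq //=; last by rewrite mem_undup map_f.
rewrite [X in _ + X]big1 ?addr0 => [|w wt]; last first.
  rewrite big1 // => i _; rewrite thread_coordE thP /=.
  by rewrite eq_sym (negPf wt) scale0r.
rewrite [LHS]nodeE; apply: eq_bigr => i _.
by rewrite thread_coordE thP /= eqxx.
Qed.

Lemma thread_module_trace : trace Q = I.
Proof.
have [[I0 IB IM] IMr] := tI.
apply/seteqP; split=> [_ [n [f [p ->]]]|h /I_div[d _ ->]].
  apply: left_ideal_sum => // i _.
  apply: (thread_module_ind (Y := [set q | I (f i q)])).
    split; first by rewrite /= linear0.
    move=> a q q' Iq Iq' /=; rewrite linearP; apply: (left_idealD tI.1) => //.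
    exact: (IMr a _ Iq).
  move=> m w; rewrite /= nodeE linear_sum.
  pose G j : S := f i ((x j : S^c) *: node m.+1 (j :: w)).
  change (I (\sum_(j < k) G j)); apply: (left_ideal_sum _ tI.1) => j _.
  rewrite /G linearZ; exact: (IM _ _ (xI j)).
have /choice[th thP] : forall i, exists t : thread, sval t 0%N = fun w => x i.
  by move=> i; apply: thread_through.
have lf i : linear (fun q : Q => (d i * thread_coord (th i) q : S) : (S^c)^o).
  move=> a q q'; rewrite linearP.
  change (d i * ((thread_coord (th i) q : S) * a + (thread_coord (th i) q' : S)) =
    d i * (thread_coord (th i) q : S) * a + d i * (thread_coord (th i) q' : S)).
  by rewrite mulrDr mulrA.
exists k, (fun i => mk_linear (lf i)), (fun=> node 0 [::]).
apply: eq_bigr => i _.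
change (d i * x i = d i * (thread_coord (th i) (node 0 [::]) : S)).
by rewrite thread_coordE thP.
Qed.

Theorem idempotent_ideal_trace : exists Q : lmodType S^c,
  [/\ count_gen Q, projective Q & trace Q = I].
Proof.
exists thread_module; split.
- exact: thread_module_count_gen.
- exact: thread_module_projective.
- exact: thread_module_trace.
Qed.

End IdempotentIdealTrace.

(** * Big projective modules *)
Section IdealOfSet.
Variables (S : pzRingType) (X : set S) (tX : two_sided X).

Definition set_pred : {pred S} := fun x => `[<X x>].

Lemma set_pred_zmod : zmod_closed set_pred.
Proof.
have [[X0 XB _] _] := tX; split; first exact/asboolP.
by move=> x y /asboolP Xx /asboolP Xy; apply/asboolP; apply: XB.
Qed.

Lemma set_pred_mull s x : x \in set_pred -> s * x \in set_pred.
Proof. by have [[_ _ XM] _] := tX => /asboolP Xx; apply/asboolP; apply: XM. Qed.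

Lemma set_pred_mulr s x : x \in set_pred -> x * s \in set_pred.
Proof. by have [_ XM] := tX => /asboolP Xx; apply/asboolP; apply: XM. Qed.

Definition ideal_of_set : ideal S := Ideal set_pred_zmod set_pred_mull set_pred_mulr.

Lemma mem_ideal_of_set x : (x \in ideal_of_set) <-> X x.
Proof. by split=> [/asboolP|Xx] //; apply/asboolP. Qed.

End IdealOfSet.

Section BigProjective.
Variables (S : pzRingType) (Z : set S).
Hypothesis SZ : centrally_noetherian Z.
Variables (P : lmodType S^c) (b : nat -> P) (phi : nat -> {linear P -> (S^c)^o}).
Hypothesis bphi : element_basis b phi.

(** The value of phi_i seen in S, where it transforms by multiplication on the
right. *)
Definition coord (i : nat) (p : P) : S := phi i p.

Lemma coordB i p q : coord i (p - q) = coord i p - coord i q.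
Proof. exact: (linearB (phi i)). Qed.

Lemma coordD i p q : coord i (p + q) = coord i p + coord i q.
Proof. exact: (linearD (phi i)). Qed.

Lemma coord0 i : coord i 0 = 0.
Proof. exact: (linear0 (phi i)). Qed.

Lemma coordZ i (s : S) p : coord i ((s : S^c) *: p) = coord i p * s.
Proof. by rewrite /coord linearZ. Qed.

Lemma coord_sum i (r : seq nat) (F : nat -> P) :
  coord i (\sum_(j <- r) F j) = \sum_(j <- r) coord i (F j).
Proof. by rewrite /coord (linear_sum (phi i)). Qed.

Lemma coord_bound p : exists n, forall i, (n <= i)%N -> coord i p = 0.
Proof. by have [n [pn _]] := bphi p; exists n. Qed.

Lemma coord_bound_seq (s : seq P) :
  exists n, forall p i, p \in s -> (n <= i)%N -> coord i p = 0.
Proof.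
elim: s => [|p s [n sn]]; first by exists 0%N.
have [m pm] := coord_bound p; exists (maxn m n) => q i.
rewrite in_cons geq_max => /predU1P[->|qs] /andP[mi ni]; first exact: pm.
exact: sn.
Qed.

Definition tail_ideal n :=
  left_span [set x | exists i p, (n <= i)%N /\ x = coord i p].

Lemma tail_gen n i p : (n <= i)%N -> tail_ideal n (coord i p).
Proof. by move=> ni; apply: left_span_gen; exists i, p. Qed.

Lemma tail_two_sided n : two_sided (tail_ideal n).
Proof.
apply: left_span_two_sided => s _ [i [p [ni ->]]].
by exists i, ((s : S^c) *: p); rewrite coordZ.
Qed.

Lemma tail_left n : left_ideal (tail_ideal n).
Proof. by case: (tail_two_sided n). Qed.

Lemma tail_sub m n : (m <= n)%N -> tail_ideal n `<=` tail_ideal m.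
Proof.
move=> mn; apply: left_span_min; first exact: tail_left.
by move=> _ [i [p [ni ->]]]; apply: tail_gen; apply: leq_trans ni.
Qed.

Lemma tail_mul n : exists m0, forall m, (m0 <= m)%N ->
  tail_ideal m `<=` ideal_mul (tail_ideal m) (tail_ideal n).
Proof.
have [m0 m0P] := coord_bound_seq (map b (iota 0 n)); exists m0 => m m0m.
have lI : left_ideal (ideal_mul (tail_ideal m) (tail_ideal n)).
  by apply: ideal_mul_left; apply: tail_left.
apply: left_span_min => // _ [i [p [mi ->]]].
have [N [_ pE]] := bphi p; rewrite {1}pE -(big_mkord xpredT (fun j => phi j p *: b j)).
rewrite coord_sum; apply: left_ideal_sum => // j _.
rewrite (coordZ i (coord j p)); have [jn|nj] := ltnP j n.
  rewrite m0P ?mul0r; first by case: lI.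
    by apply: map_f; rewrite mem_iota.
  exact: leq_trans mi.
by apply: ideal_mul_gen; apply: tail_gen.
Qed.

Lemma tail_stable : exists n0, forall m, (n0 <= m)%N ->
  tail_ideal n0 `<=` tail_ideal m.
Proof.
apply: (ideal_chain_stabilizes (centrally_noetherian_acc SZ)
  (centrally_noetherian_determines SZ)).
- exact: tail_two_sided.
- by move=> n; apply: tail_sub.
- exact: tail_mul.
Qed.

(** As S is noetherian on the right, P is the sum of a finitely generated submodule
and the submodule where the first n coordinates vanish.  The generators have
bounded support, so the first n coordinates can be cleared without changing
those beyond the bound. *)
Lemma clear_coords n : exists m, forall p, exists p',
  (forall i, (i < n)%N -> coord i p' = 0) /\
  (forall i, (m <= i)%N -> coord i p = coord i p').
Proof.
elim: n => [|n [m mP]]; first by exists 0%N => p; exists p.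
pose kills p := forall i, (i < n)%N -> coord i p = 0.
have killsB p q : kills p -> kills q -> kills (p - q).
  by move=> kp kq i ni; rewrite coordB kp // kq // subrr.
have killsZ p (s : S) : kills p -> kills ((s : S^c) *: p).
  by move=> kp i ni; rewrite coordZ kp // mul0r.
have kills0 : kills 0 by move=> i _; rewrite coord0.
have [s [sX Xs]] : op_fg (mul_ops Z) [set x | exists2 p, kills p & coord n p = x].
  apply: SZ.2; apply: right_closed_op_closed => //.
  - by exists 0; rewrite ?coord0.
  - by move=> _ _ [p kp <-] [q kq <-]; exists (p - q); rewrite ?coordB //; apply: killsB.
  - move=> t _ [p kp <-]; exists ((t : S^c) *: p); rewrite ?coordZ //.
    exact: killsZ.
(* Generators of the right ideal of values of the n-th coordinate, lifted to
   elements with vanishing first n coordinates. *)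
have [m' m'P] : exists m', forall a, a \in s -> exists p,
    [/\ kills p, coord n p = a & forall i, (m' <= i)%N -> coord i p = 0].
  elim: s sX {Xs} => [|a s IHs] sX; first by exists 0%N.
  have [m' m'P] := IHs (fun c cs => sX c (mem_behead (s := a :: s) cs)).
  have [p kp pa] := sX a (mem_head _ _); have [k pk] := coord_bound p.
  exists (maxn k m') => c; rewrite in_cons => /predU1P[->|/m'P[q [kq qc q0]]].
    by exists p; split=> // i; rewrite geq_max => /andP[+ _]; apply: pk.
  by exists q; split=> // i; rewrite geq_max => /andP[_]; apply: q0.
exists (maxn m m') => p; have [p' [p'0 pp']] := mP p.
have [|||w [kw wp' w0]] := Xs [set x | exists p,
    [/\ kills p, coord n p = x & forall i, (m' <= i)%N -> coord i p = 0]]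
    _ _ (coord n p').
- apply: right_closed_op_closed SZ _ _ _ _.
  + by exists 0; split=> //; rewrite ?coord0 // => i _; rewrite coord0.
  + move=> _ _ [q [kq <- q0]] [r [kr <- r0]]; exists (q - r).
    split; [exact: killsB|by rewrite coordB|move=> i mi].
    by rewrite coordB q0 // r0 // subrr.
  + move=> t _ [q [kq <- q0]]; exists ((t : S^c) *: q).
    by split; [exact: killsZ|rewrite coordZ|move=> i mi; rewrite coordZ q0 // mul0r].
- exact: m'P.
- by exists p'.
exists (p' - w); split=> i.
  rewrite ltnS leq_eqVlt => /predU1P[->|i_n]; rewrite coordB ?wp' ?subrr //.
  by rewrite p'0 // kw // subrr.
by rewrite geq_max => /andP[mi m'i]; rewrite coordB w0 // subr0 pp'.
Qed.

Section Stable.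
Variable n0 : nat.
Hypothesis n0P : forall m, (n0 <= m)%N -> tail_ideal n0 `<=` tail_ideal m.
Local Notation I := (tail_ideal n0).

Lemma stable_idempotent : I `<=` ideal_mul I I.
Proof.
have [m mP] := tail_mul n0.
have sub : I `<=` ideal_mul (tail_ideal (maxn m n0)) I.
  by move=> x /(n0P (leq_maxr m n0)); apply: mP; apply: leq_maxl.
move=> x /sub; apply: ideal_mul_sub; first by apply/ideal_mul_left/tail_left.
by move=> u v /(tail_sub (leq_maxr m n0)) Iu Iv; apply: ideal_mul_gen.
Qed.

(** Take p with vanishing first n coordinates and with a maximal left ideal of
coordinates.  Adding to p an element q' supported beyond p joins the two left
ideals, so the coordinates of q' are already in that of p.  By [clear_coords]
the coordinates of such q' generate a tail ideal. *)
Lemma spanning_vector n : exists p, (forall i, (i < n)%N -> coord i p = 0) /\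
  I `<=` left_span (range (coord^~ p)).
Proof.
pose F := [set L | exists2 p, (forall i, (i < n)%N -> coord i p = 0) &
                  L = left_span (range (coord^~ p))].
have [||_ [p p0 ->] pmax] := centrally_noetherian_max SZ (F := F).
- by exists (left_span (range (coord^~ 0))), 0 => // i _; rewrite coord0.
- by move=> _ [p _ ->]; apply: left_span_ideal.
exists p; split=> //; have [m1 m1p] := coord_bound p.
pose n' := maxn n m1; have [m mP] := clear_coords n'.
have lL q : left_ideal (left_span (range (coord^~ q))) by apply: left_span_ideal.
move=> x /(n0P (leq_maxr m n0)); apply: left_span_min x => // _ [i [q [mi ->]]].
have [q' [q'0 qq']] := mP q.
rewrite qq'; last by apply: leq_trans mi; apply: leq_maxl.
apply: (pmax (left_span (range (coord^~ (p + q'))))).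
- exists (p + q') => // j jn; rewrite coordD p0 // q'0 ?addr0 //.
  by apply: (leq_trans jn); apply: leq_maxl.
- apply: left_span_min => // _ [j _ <-]; have [jn'|n'j] := ltnP j n'.
    by apply: left_span_gen; exists j; rewrite // coordD q'0 // addr0.
  rewrite m1p; first by case: (lL (p + q')).
  by apply: leq_trans n'j; apply: leq_maxr.
- have [jn'|n'j] := ltnP i n'; first by rewrite q'0 //; case: (lL (p + q')).
  apply: left_span_gen; exists i; rewrite // coordD m1p ?add0r //.
  by apply: leq_trans n'j; apply: leq_maxr.
Qed.

Variable I : ideal S.
Hypothesis IE : forall x, x \in I <-> tail_ideal n0 x.

(** With p a spanning vector, Q I is spanned by the y s for s among the coordinates
of p. *)
Lemma block_vector (Q : lmodType S^c) (q : Q) n : q \in mod_mul Q I ->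
  exists p m (y : nat -> Q), [/\ (n < m)%N, forall i, (i < n)%N -> coord i p = 0,
    forall i, (m <= i)%N -> coord i p = 0 &
    q = \sum_(i < m) (coord i p : S^c) *: y i].
Proof.
move=> /asboolP[k [s [u [sI ->]]]].
have [p [p0 Ip]] := spanning_vector n; have [m pm] := coord_bound p.
exists p, (maxn n.+1 m).
suff [y yE] : exists y : nat -> Q, \sum_(t < k) (s t : S^c) *: u t =
    \sum_(i < maxn n.+1 m) (coord i p : S^c) *: y i.
  exists y; split=> //; first exact: leq_maxl.
  by move=> i; rewrite geq_max => /andP[_]; apply: pm.
pose rep := [set v : Q | exists y : nat -> Q,
  v = \sum_(i < maxn n.+1 m) (coord i p : S^c) *: y i].
have rep0 : rep 0 by exists (fun=> 0); rewrite big1 // => i _; rewrite scaler0.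
have repB v w : rep v -> rep w -> rep (v - w).
  move=> [y ->] [z ->]; exists (fun i => y i - z i).
  by rewrite -sumrB; apply: eq_bigr => i _; rewrite scalerBr.
have repD v w : rep v -> rep w -> rep (v + w).
  move=> [y ->] [z ->]; exists (fun i => y i + z i).
  by rewrite -big_split; apply: eq_bigr => i _; rewrite scalerDr.
suff repI a v : tail_ideal n0 a -> rep ((a : S^c) *: v).
  suff : rep (\sum_(t < k) (s t : S^c) *: u t) by [].
  by apply: (big_ind rep) => // t _; apply: repI; apply/IE.
move=> /Ip aL.
apply: (aL [set c : S | forall v : Q, rep ((c : S^c) *: v)]) => [|_ [j _ <-] {}v].
  split=> [w|c d rc rd w|c d rd w]; first by rewrite scale0r.
    by rewrite scalerBl; apply: repB.
  by have := rd ((c : S^c) *: w); rewrite scalerA.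
have [jm|mj] := ltnP j (maxn n.+1 m).
  exists (fun i => if i == j then v else 0).
  rewrite (bigD1 (Ordinal jm)) //= eqxx big1 ?addr0 // => i ij.
  by rewrite ifN ?scaler0 //; apply: contra ij => /eqP ij; apply/eqP/val_inj.
rewrite pm ?scale0r //.
by move: mj; rewrite geq_max => /andP[].
Qed.

(** The vectors p_k for the generators g_k of Q are chosen with supports in
consecutive intervals [c k, c (k + 1)), and h_k reads only the coordinates in
the k-th interval.  So the sum of the h_k maps p_k to g_k. *)
Theorem stable_tail_big : big I P.
Proof.
split; [exact: element_basis_count_gen bphi|exact: element_basis_projective bphi|].
move=> Q /count_genP[g gQ] _ QI.
have /choice[d dP] : forall t : nat * nat, exists d : P * nat * (nat -> Q),
    [/\ (t.1 < d.1.2)%N, forall i, (i < t.1)%N -> coord i d.1.1 = 0,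
    forall i, (d.1.2 <= i)%N -> coord i d.1.1 = 0 &
    g t.2 = \sum_(i < d.1.2) (coord i d.1.1 : S^c) *: d.2 i].
  move=> [n k] /=; have [p [m [y pmy]]] := block_vector n (QI (g k)).
  by exists (p, m, y).
pose c := fix c (k : nat) := if k is j.+1 then (d (c j, j)).1.2 else 0%N.
pose p k := (d (c k, k)).1.1; pose y k := (d (c k, k)).2.
have cS k : (c k < c k.+1)%N by case: (dP (c k, k)).
have c_le j k : (j <= k)%N -> (c j <= c k)%N.
  elim: k => [|k IHk]; first by rewrite leqn0 => /eqP->.
  by rewrite leq_eqVlt => /predU1P[->//|/IHk]/leq_trans; apply; apply: ltnW.
have c_ge k : (k <= c k)%N by elim: k => // k /leq_ltn_trans; apply.
have /choice[h hE] : forall k, exists h : {linear P -> Q}, forall x,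
    h x = \sum_(i < c k.+1 | (c k <= i)%N) (coord i x : S^c) *: y k i.
  move=> k; apply: linear_ex => a x x'; rewrite scaler_sumr -big_split.
  by apply: eq_bigr => i _; rewrite /coord linearP scalerDl scalerA.
have [|H HP] := @locally_finite_sum _ P Q h.
  move=> x; have [n xn] := coord_bound x; exists n => k nk.
  rewrite hE big1 // => i ki; rewrite xn ?scale0r //.
  by apply: leq_trans ki; apply: leq_trans nk _.
exists H; suff Hp k : H (p k) = g k.
  apply: (gQ [set v | exists x, H x = v]) => [|k]; last by exists (p k).
  split; first by exists 0; rewrite linear0.
  by move=> a _ _ [x <-] [x' <-]; exists (a *: x + x'); rewrite linearP.
have [_ pl pr gE] := dP (c k, k).
rewrite (HP _ k.+1) => [|j kj]; last first.
  rewrite hE big1 // => i ji; rewrite [coord _ _]pr ?scale0r //.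
  by apply: leq_trans ji; apply: (c_le k.+1 j).
rewrite big_ord_recr /= big1 ?add0r => [|j _]; last first.
  rewrite hE big1 // => i ji; rewrite [coord _ _]pl ?scale0r //=.
  by apply: (leq_trans (ltn_ord i)); apply: c_le.
rewrite hE gE [RHS](bigID (fun i : 'I__ => (c k <= i)%N)) /=.
rewrite [X in _ = _ + X]big1 ?addr0 // => i; rewrite -ltnNge => ik.
by rewrite [coord _ _]pl ?scale0r.
Qed.

(** Idempotency provides the division by left generators of I that
[idempotent_ideal_trace] asks for, with quotients in I. *)
Theorem stable_tail_trace : trace_ideals I.
Proof.
pose T := tail_ideal n0.
have [s [sI Is]] : op_fg (mul_ops Z) T.
  by apply: SZ.2; apply: left_ideal_op_closed; apply: tail_left.
pose x (i : 'I_(size s)) := tnth (in_tuple s) i.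
have lT : left_ideal T := tail_left n0; have [T0 TB TM] := lT.
have [Q [cQ pQ trQ]] : exists Q : lmodType S^c,
    [/\ count_gen Q, projective Q & trace Q = T]; last first.
  by exists Q; split=> //; rewrite trQ; apply/seteqP; split=> a /IE.
apply: (idempotent_ideal_trace (x := x) (tail_two_sided n0)) => [i|h].
  by apply: sI; apply: mem_tnth.
pose D := [set h | exists2 e : 'I_(size s) -> S, (forall i, T (e i)) &
  h = \sum_(i < size s) e i * x i].
have D0 : D 0 by exists (fun=> 0) => //; rewrite big1 // => i _; rewrite mul0r.
have DB u v : D u -> D v -> D (u - v).
  move=> [e eT ->] [f fT ->]; exists (fun i => e i - f i); first by move=> i; apply: TB.
  by rewrite -sumrB; apply: eq_bigr => i _; rewrite mulrBl.
move=> /stable_idempotent Th; apply: (Th D) => // u v Tu Tv.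
apply: (Is [set v | forall u, T u -> D (u * v)] _ _ v Tv u Tu).
  split=> [w _|w w' Dw Dw' t Tt|_ w [z _ ->] Dw t Tt]; first by rewrite mulr0.
    by rewrite mulrBr; apply: DB; [apply: Dw|apply: Dw'].
  by rewrite mulrA; apply: Dw; apply: (tail_two_sided n0).2.
move=> a as_ t Tt; have i_s : (index a s < size s)%N by rewrite index_mem.
exists (fun i => if i == Ordinal i_s then t else 0).
  by move=> i; case: ifP.
rewrite (bigD1 (Ordinal i_s)) //= eqxx big1 ?addr0 => [|i /negPf->]; last first.
  by rewrite mul0r.
by rewrite /x (tnth_nth a) /= nth_index.
Qed.

Lemma coord_mod_mul i p : p \in mod_mul P I -> coord i p \in I.
Proof.
move=> /asboolP[k [s [u [sI ->]]]]; rewrite /coord linear_sum.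
apply: (big_ind (fun v : S => v \in I)) => [||t _]; first exact: rpred0.
  by move=> v w; apply: rpredD.
by rewrite linearZ; apply: ideal_mull.
Qed.

Local Notation T := (quot_ring I)^c.
Local Notation red := (reduction P I).

Definition red_pi (p : P) : red := quot_mod_pi (mod_mul P I) p.

Definition red_coord (i : nat) (x : red) : T^o :=
  quot_ring_pi I (coord i (quot_mod_repr (x : quot_mod (mod_mul P I)))).

Lemma red_piK (x : red) : exists p, x = red_pi p.
Proof.
exists (quot_mod_repr (x : quot_mod (mod_mul P I))).
by rewrite /red_pi quot_mod_reprK.
Qed.

Lemma red_piD p q : red_pi (p + q) = red_pi p + red_pi q.
Proof. exact: quot_mod_piD. Qed.

Lemma red_piZ (s : S) p :
  red_pi ((s : S^c) *: p) = (quot_ring_pi I s : T) *: red_pi p.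
Proof. by rewrite [RHS]reduction_scaleE [RHS]quot_mod_scaleE. Qed.

Lemma red_coordE i p : red_coord i (red_pi p) = quot_ring_pi I (coord i p).
Proof.
apply/quot_ring_piP; rewrite -coordB; apply: coord_mod_mul.
by apply/quot_mod_piP; rewrite quot_mod_reprK.
Qed.

Lemma red_coord_linear i : linear (red_coord i).
Proof.
move=> a x y; have [p ->] := red_piK x; have [q ->] := red_piK y.
rewrite -[a](@quot_ring_reprK S I) -red_piZ -red_piD !red_coordE.
by rewrite coordD coordZ quot_ring_piD -quot_ring_piM.
Qed.

Lemma red_coord_tail i x : (n0 <= i)%N -> red_coord i x = 0.
Proof.
move=> ni; have [p ->] := red_piK x; rewrite red_coordE.
have pi0 : quot_ring_pi I 0 = 0.
  by apply: (addrI (quot_ring_pi I 0)); rewrite -quot_ring_piD !addr0.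
by rewrite -pi0; apply/quot_ring_piP; rewrite subr0; apply/IE; apply: tail_gen.
Qed.

(** The dual basis of P induces one of P / P I, where only the first n0 functionals
survive. *)
Lemma red_element_basis :
  element_basis (fun i => red_pi (b i)) (fun i => mk_linear (red_coord_linear i)).
Proof.
move=> x; exists n0; split; first by move=> i; apply: red_coord_tail.
have [p ->] := red_piK x; have [n [pn _]] := bphi p.
pose F i := (red_coord i (red_pi p) : T) *: red_pi (b i).
rewrite -[RHS](sum_ord_extend (F := F) (leq_maxl n0 n)) => [|i ni]; last first.
  by rewrite /F red_coord_tail // scale0r.
have pE : p = \sum_(i < maxn n0 n) (coord i p : S^c) *: b i.
  by apply: (element_basisE bphi) => i; rewrite geq_max => /andP[_]; apply: pn.
rewrite [in LHS]pE {pE}.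
elim/big_rec2: _ => [|i u v _ <-].
  by have := red_piD 0 0; rewrite addr0 => /(canLR (addrK _)); rewrite subrr.
by rewrite red_piD (red_piZ (coord i p)) /F red_coordE.
Qed.

Theorem stable_tail_reduction : fin_gen red /\ projective red.
Proof.
split; last exact: element_basis_projective red_element_basis.
exists n0, (fun i => red_pi (b i)) => x.
exists (fun i => red_coord i x : T).
by apply: (element_basisE red_element_basis) => i; apply: red_coord_tail.
Qed.

End Stable.

Theorem projective_big : exists (n0 : nat) (I : ideal S),
  [/\ forall i p, (n0 <= i)%N -> (phi i p : S) \in I, trace_ideals I, big I P,
      fin_gen (reduction P I) & projective (reduction P I)].
Proof.
have [n0 n0P] := tail_stable.
have IE := mem_ideal_of_set (tail_two_sided n0).
have [fgr pr] := stable_tail_reduction IE.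
exists n0, (ideal_of_set (tail_two_sided n0)); split=> //.
- by move=> i p ni; apply/IE; apply: tail_gen.
- exact: stable_tail_trace n0P _ IE.
- exact: stable_tail_big n0P _ IE.
Qed.

End BigProjective.

(** * Finite generation *)
Section FiniteGeneration.
Variable R : pzRingType.
Implicit Types A B N P Q : lmodType R.

Lemma fin_gen_generates A (I : finType) (g : I -> A) : generates g -> fin_gen A.
Proof.
move=> gen; exists #|I|, (fun i => g (enum_val i)) => x.
have := gen [set x | exists c : 'I_#|I| -> R, x = \sum_i c i *: g (enum_val i)].
apply=> [|i].
  split; first by exists (fun=> 0); rewrite big1 // => i _; rewrite scale0r.
  move=> a _ _ [c ->] [d ->]; exists (fun i => a * c i + d i).
  rewrite scaler_sumr -big_split; apply: eq_bigr => i _.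
  by rewrite scalerDl scalerA.
exists (fun j => (j == enum_rank i)%:R).
rewrite (bigD1 (enum_rank i)) //= eqxx enum_rankK scale1r big1 ?addr0 // => j /negPf->.
by rewrite scale0r.
Qed.

Lemma hom_image_fin_gen A B : hom_image A B -> fin_gen A -> fin_gen B.
Proof.
move=> [f fsurj] [n [g gP]]; exists n, (f \o g) => y; have [x <-] := fsurj y.
have [c ->] := gP x; exists c; rewrite linear_sum.
by apply: eq_bigr => i _; rewrite linearZ.
Qed.

Lemma dsum_fin_gen (X : finType) A : fin_gen A -> fin_gen (dsum X A).
Proof.
move=> [n [g gP]].
apply: (@fin_gen_generates _ (X * 'I_n)%type (fun t => dsum_delta A t.1 (g t.2))).
move=> F sF Fg; apply: dsum_generates => // a v; have [c ->] := gP v.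
rewrite linear_sum; apply: submod_set_sum => // i _; rewrite linearZ.
by apply: submod_setZ => //; apply: (Fg (a, i)).
Qed.

Lemma summand_hom_image N B : is_summand N B -> hom_image B N.
Proof. by move=> /summand_retract[i [p ip]]; exists p => y; exists (i y). Qed.

Lemma isomorphic_hom_image A B : isomorphic A B -> hom_image A B.
Proof. by move=> [f [g _ gf]]; exists f => y; exists (g y). Qed.

Lemma isomorphic_summand A N B : isomorphic A N -> is_summand A B -> is_summand N B.
Proof.
move=> /isomorphic_inv[f [g [fg gf]]] /summand_retract[i [p ip]].
apply: (@retract_summand _ _ _ (i \o g) (f \o p)) => x.
by change (f (p (i (g x))) = x); rewrite ip gf.
Qed.

Lemma fin_gen_locally_finite A B (phi : nat -> {linear A -> B}) : fin_gen A ->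
    (forall x, exists n, forall i, (n <= i)%N -> phi i x = 0) ->
  exists n, forall i x, (n <= i)%N -> phi i x = 0.
Proof.
move=> [k [g gP]] /choice[d dP]; exists (\max_(j < k) d (g j)) => i x ni.
have [c ->] := gP x; rewrite linear_sum big1 // => j _.
rewrite linearZ /= dP ?scaler0 //; apply: leq_trans ni.
exact: (leq_bigmax (F := fun j : 'I_k => d (g j))).
Qed.

End FiniteGeneration.

(** Let Q be a countably generated projective module with trace I.  A dual basis
shows Q I = Q, so P maps onto the sum of countably many copies of Q, which is
finitely generated only if Q = 0. *)
Lemma big_not_fin_gen (S : pzRingType) (I : ideal S) (P : lmodType S^c) :
  trace_ideals I -> [set x | x \in I] <> [set 0] -> big I P -> ~ fin_gen P.
Proof.
move=> [Q [cQ pQ IQ]] I0 [_ _ bigP] fP; apply: I0.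
have [b [phi bphi]] := projective_element_basis cQ pQ.
have memI i q : (phi i q : S) \in I.
  suff : [set x | x \in I] (phi i q : S) by [].
  by rewrite IQ; exists 1%N, (fun=> phi i), (fun=> q); rewrite big_ord1.
have fQ : fin_gen (dsum nat Q).
  apply: hom_image_fin_gen fP; apply: bigP.
  - exact: dsum_count_gen.
  - exact: dsum_nat_projective.
  - apply: (dsum_generates (F := [set q | q \in mod_mul (dsum nat Q) I])).
      split=> [|a x y Ix Iy]; first exact: rpred0.
      by apply: rpredD => //; apply: rpredZ.
    move=> a v; have [n [_ vE]] := bphi v; apply/asboolP.
    exists n, (fun i => phi i v), (fun i => dsum_delta Q a (b i)); split=> //.
    by rewrite {1}vE linear_sum; apply: eq_bigr => i _; rewrite linearZ.
have [n nP] := fin_gen_locally_finite (phi := dsum_coord Q) fQ (@dsum_nat_bound _ Q).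
have Q0 (q : Q) : q = 0.
  have := nP n (dsum_delta Q n q) (leqnn _).
  by change (dsum_delta Q n q n = 0 -> q = 0); rewrite dsum_deltaE; case: asboolP.
rewrite IQ; apply/seteqP; split=> [_ [m [f [p ->]]]|_ ->].
  by rewrite big1 // => i _; rewrite [p i]Q0 linear0.
by exists 0%N, (fun=> phi 0%N), (fun=> 0); rewrite big_ord0.
Qed.

(** * Homomorphism modules and tensor products *)
Section HomModule.
Variables (R : comPzRingType) (M N : lmodType R).

(** Hom_R(M, N) as a right module over S = End_R(M), acting by composition. *)
Definition hom_module := {linear M -> N}.
Implicit Types f g h : hom_module.

HB.instance Definition _ := gen_eqMixin hom_module.
HB.instance Definition _ := gen_choiceMixin hom_module.

Lemma homP f g : f =1 g -> f = g.
Proof.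
case: f g => [f [[f1] [f2]]] [g [[g1] [g2]]] /= /funext fg.
rewrite /= in fg; subst g.
by rewrite (Prop_irrelevance f1 g1) (Prop_irrelevance f2 g2).
Qed.

Definition hom_zero : hom_module := \0.
Definition hom_opp f : hom_module := \- f.
Definition hom_add f g : hom_module := f \+ g.
Definition hom_comp (s : (endo M)^c) f : hom_module := f \o (s : endo M).

Lemma hom_addA : associative hom_add.
Proof. by move=> f g h; apply: homP => x /=; rewrite addrA. Qed.
Lemma hom_addC : commutative hom_add.
Proof. by move=> f g; apply: homP => x /=; rewrite addrC. Qed.
Lemma hom_add0 : left_id hom_zero hom_add.
Proof. by move=> f; apply: homP => x /=; rewrite add0r. Qed.
Lemma hom_addN : left_inverse hom_zero hom_opp hom_add.
Proof. by move=> f; apply: homP => x /=; rewrite addNr. Qed.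

HB.instance Definition _ :=
  GRing.isZmodule.Build hom_module hom_addA hom_addC hom_add0 hom_addN.

Lemma hom_compA s t f : hom_comp s (hom_comp t f) = hom_comp (s * t) f.
Proof. exact: homP. Qed.
Lemma hom_comp1 : left_id 1 hom_comp.
Proof. by move=> f; apply: homP. Qed.
Lemma hom_compDr : right_distributive hom_comp +%R.
Proof. by move=> s f g; apply: homP. Qed.
Lemma hom_compDl f : {morph hom_comp^~ f : s t / s + t}.
Proof. by move=> s t; apply: homP => x /=; rewrite linearD. Qed.

HB.instance Definition _ := GRing.Zmodule_isLmodule.Build (endo M)^c hom_module
  hom_compA hom_comp1 hom_compDr hom_compDl.

Lemma hom_sumE n (F : 'I_n -> hom_module) x :
  (\sum_(i < n) F i) x = \sum_(i < n) F i x.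
Proof. by apply: (big_morph (fun f : hom_module => f x)). Qed.

End HomModule.

Section Tensor.
Variables (R : comPzRingType) (M : lmodType R).
Local Notation S := (endo M).
Variable P : lmodType S^c.

Lemma dsum_lift (X : choiceType) (W : lmodType R) (f : X -> W) :
  exists h : {linear dsum X R^o -> W},
    forall a (r : R), h (dsum_delta R^o a r) = r *: f a.
Proof.
have /choice[supp suppP] : forall x : dsum X R^o, exists s : seq X,
    uniq s /\ forall a, (a \in s) = (x a != 0).
  by move=> x; have [s [us sx _]] := dsum_supportP x; exists s.
pose h (x : dsum X R^o) : W := \sum_(a <- supp x) (x a : R) *: f a.
have hE (x : dsum X R^o) (s : seq X) : uniq s -> (forall a, x a != 0 -> a \in s) ->
    h x = \sum_(a <- s) (x a : R) *: f a.
  have [ux sx] := suppP x => us xs; apply: sum_eq_support => // a xfa.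
    by rewrite sx; apply: contraNneq xfa => ->; rewrite scale0r.
  by apply: xs; apply: contraNneq xfa => ->; rewrite scale0r.
have lh : linear h.
  move=> c x y; pose s := undup (supp (c *: x + y) ++ supp x ++ supp y).
  rewrite !(hE _ s) ?undup_uniq // => [|a|a|a]; last 3 first.
  - by rewrite mem_undup !mem_cat !(suppP _).2 => ->; rewrite !orbT.
  - by rewrite mem_undup !mem_cat !(suppP _).2 => ->; rewrite !orbT.
  - by rewrite mem_undup !mem_cat !(suppP _).2 => ->.
  rewrite scaler_sumr -big_split; apply: eq_bigr => a _.
  by rewrite /= scalerA -scalerDl.
exists (mk_linear lh) => a r; change (h (dsum_delta R^o a r) = r *: f a).
rewrite (hE _ [:: a]) // => [|b]; first by rewrite big_seq1 dsum_deltaE; case: asboolP.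
by rewrite dsum_deltaE mem_seq1; case: asboolP => [->|]; rewrite eqxx.
Qed.

Definition tens (p : P) (m : M) : tensor P :=
  quot_mod_pi (span_set (@tensor_rel R M P)) (tensor_gen p m).

Local Notation pi := (quot_mod_pi (span_set (@tensor_rel R M P))).

Lemma tens_rel u v : tensor_rel (u - v) -> pi u = pi v.
Proof.
move=> uv; apply/quot_mod_piP/asboolP.
exists 1%N, (fun=> 1), (fun=> u - v); split=> //.
by rewrite big_ord1 scale1r.
Qed.

Lemma tensDl p q m : tens (p + q) m = tens p m + tens q m.
Proof.
rewrite [RHS](_ : _ = pi (tensor_gen p m + tensor_gen q m)); last first.
  by rewrite quot_mod_piD.
by apply: tens_rel; rewrite opprD addrA; apply: TensorDl.
Qed.

Lemma tensDr p m n : tens p (m + n) = tens p m + tens p n.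
Proof.
rewrite [RHS](_ : _ = pi (tensor_gen p m + tensor_gen p n)); last first.
  by rewrite quot_mod_piD.
by apply: tens_rel; rewrite opprD addrA; apply: TensorDr.
Qed.

Lemma tensS p (s : S) m : tens ((s : S^c) *: p) m = tens p (s m).
Proof. by apply: tens_rel; apply: TensorS. Qed.

Lemma tensZ p (r : R) m : tens p (r *: m) = r *: tens p m.
Proof.
rewrite [RHS](_ : _ = pi (r *: tensor_gen p m)); last exact: quot_mod_scaleE.
by apply/esym/tens_rel; apply: TensorR.
Qed.

Lemma tens_linear p : linear (tens p).
Proof. by move=> r m n; rewrite tensDr tensZ. Qed.

Lemma tens0l m : tens 0 m = 0.
Proof.
by have := tensDl 0 0 m; rewrite addr0 => /(canLR (addrK _)); rewrite subrr.
Qed.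

Lemma tens_suml n (p : 'I_n -> P) m :
  tens (\sum_(i < n) p i) m = \sum_(i < n) tens (p i) m.
Proof.
by apply: (big_morph (tens^~ m)) => [p1 p2|]; [apply: tensDl|apply: tens0l].
Qed.

Lemma tens_generates (Y : set (tensor P)) : submod_set Y ->
  (forall p m, Y (tens p m)) -> forall x, Y x.
Proof.
move=> [Y0 YD] Yt x; rewrite -[x]quot_mod_reprK; move: (quot_mod_repr x) => {x}.
apply: (dsum_generates (F := [set v | Y (pi v)])).
  split=> [|a u v Yu Yv].
    rewrite /= (_ : pi 0 = 0) //.
    by have := quot_mod_piD (span_set (@tensor_rel R M P)) 0 0;
      rewrite addr0 => /(canLR (addrK _)); rewrite subrr.
  by rewrite /= quot_mod_piD -quot_mod_scaleE; apply: YD.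
move=> [p m] r /=; have -> : dsum_delta R^o (p, m) r = (r : R) *: tensor_gen p m.
  rewrite -(_ : dsum_delta R^o (p, m) 1 = tensor_gen p m) // -linearZ.
  by congr (dsum_delta _ _ _); rewrite /GRing.scale /= mulr1.
by rewrite -quot_mod_scaleE -[_ *: _]addr0; apply: YD => //; apply: Yt.
Qed.

(** The universal property of the tensor product. *)
Lemma tens_lift (W : lmodType R) (f : P -> M -> W) :
    (forall p q m, f (p + q) m = f p m + f q m) ->
    (forall p, linear (f p)) ->
    (forall p (s : S) m, f ((s : S^c) *: p) m = f p (s m)) ->
  exists F : {linear tensor P -> W}, forall p m, F (tens p m) = f p m.
Proof.
move=> fD fl fS; have [h hP] := dsum_lift (fun t : P * M => f t.1 t.2).
have hgen p m : h (tensor_gen p m) = f p m by rewrite (hP (p, m)) scale1r.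
have fE p m : f p m = mk_linear (fl p) m by [].
have h0 v : v \in span_set (@tensor_rel R M P) -> h v = 0.
  move=> /asboolP[n [c [x [xrel ->]]]]; rewrite linear_sum big1 // => i _.
  rewrite linearZ /= (_ : h (x i) = 0) ?scaler0 //.
  case: (xrel i) => [p q m|p m m'|p s m|p r m]; rewrite !linearB ?linearZ !hgen.
  - by rewrite fD [f p m + _]addrC addrK subrr.
  - by rewrite !fE linearD [X in X - _ - _]addrC addrK subrr.
  - by rewrite fS subrr.
  - by rewrite !fE linearZ subrr.
pose F (x : tensor P) := h (quot_mod_repr x).
have FE v : F (pi v) = h v.
  apply/eqP; rewrite -subr_eq0 -linearB; apply/eqP/h0.
  by apply/quot_mod_piP; rewrite quot_mod_reprK.
have lF : linear F.
  move=> a x y; rewrite -[x]quot_mod_reprK -[y]quot_mod_reprK.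
  set u := quot_mod_repr x; set v := quot_mod_repr y.
  have -> : a *: pi u + pi v = pi (a *: u + v).
    by rewrite quot_mod_piD -quot_mod_scaleE.
  by rewrite !FE linearP.
by exists (mk_linear lF) => p m; rewrite -hgen -FE.
Qed.

Variables (b : nat -> P) (phi : nat -> {linear P -> (S^c)^o}).
Hypothesis bphi : element_basis b phi.

(** A dual basis of P over S becomes one of P (x)_S M with values in M, as
S (x)_S M = M. *)
Lemma tensor_dual_basis : exists (c : nat -> {linear M -> tensor P})
    (psi : nat -> {linear tensor P -> M}),
  dual_basis c psi /\ forall i p m, psi i (tens p m) = (phi i p : S) m.
Proof.
have /choice[psi psiE] : forall i, exists F : {linear tensor P -> M},
    forall p m, F (tens p m) = (phi i p : S) m.
  move=> i; apply: tens_lift => [p q m|p|p s m].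
  - by rewrite linearD.
  - exact: linearP.
  - by rewrite linearZ.
exists (fun i => mk_linear (tens_linear (b i))), psi; split=> // x.
apply: (tens_generates (Y := [set x | exists n,
  (forall i, (n <= i)%N -> psi i x = 0) /\
  x = \sum_(i < n) mk_linear (tens_linear (b i)) (psi i x)])).
  split; first by exists 0%N; rewrite big_ord0; split=> // i _; rewrite linear0.
  move=> a u v [m [um uE]] [n [vn vE]]; exists (maxn m n); split.
    move=> i; rewrite geq_max => /andP[mi ni].
    by rewrite linearP um // vn // scaler0 addr0.
  pose G w i := mk_linear (tens_linear (b i)) (psi i w).
  rewrite [in LHS]uE [in LHS]vE.
  rewrite -(sum_ord_extend (leq_maxl m n) (F := G u)) => [|i mi]; last first.
    by rewrite /G um // linear0.
  rewrite -(sum_ord_extend (leq_maxr m n) (F := G v)) => [|i ni]; last first.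
    by rewrite /G vn // linear0.
  by rewrite scaler_sumr -big_split; apply: eq_bigr => i _; rewrite /G !linearP.
move=> p m; have [n [pn pE]] := bphi p; exists n; split=> [i ni|].
  by rewrite psiE pn.
rewrite {1}pE tens_suml; apply: eq_bigr => i _.
by rewrite psiE (tensS _ (phi i p : S)).
Qed.

End Tensor.

(** A module N with a dual basis with values in the finitely generated module M
corresponds to the projective module Hom_R(M, N). *)
Section HomTensor.
Variables (R : comPzRingType) (M N : lmodType R).
Hypothesis M_fin_gen : fin_gen M.
Variables (b : nat -> {linear M -> N}) (phi : nat -> {linear N -> M}).
Hypothesis bphi : dual_basis b phi.
Local Notation S := (endo M).
Local Notation P := (hom_module M N).

Lemma hom_coord_bound (p : P) : exists n, forall i x, (n <= i)%N -> phi i (p x) = 0.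
Proof.
apply: (fin_gen_locally_finite (phi := fun i => phi i \o p)) => // x.
by have [n [xn _]] := bphi (p x); exists n.
Qed.

Lemma hom_coord_linear i :
  linear (fun p : P => (phi i \o p : {linear M -> M}) : (S^c)^o).
Proof. by move=> s p q; apply: endoP => x; apply: (linearD (phi i)). Qed.

Definition hom_coord i : {linear P -> (S^c)^o} := mk_linear (hom_coord_linear i).

Lemma hom_element_basis : element_basis (b : nat -> P) hom_coord.
Proof.
move=> p; have [n pn] := hom_coord_bound p; exists n; split.
  by move=> i ni; apply: endoP => x; apply: pn.
apply: homP => x; rewrite hom_sumE.
exact: (dual_basisE bphi (fun i => pn i x)).
Qed.

(** Evaluation p (x) m |-> p(m) has the inverse sending x to the sum of the
b_i (x) phi_i(x). *)
Lemma tensor_hom_isomorphic : isomorphic (tensor P) N.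
Proof.
have [ev evE] : exists F : {linear tensor P -> N}, forall p m, F (tens p m) = p m.
  apply: (tens_lift (f := fun (p : P) m => p m)) => // p; exact: linearP.
have [|g gE] := @locally_finite_sum R N (tensor P)
    (fun i => mk_linear (tens_linear (b i : P)) \o phi i).
  move=> x; have [n [xn _]] := bphi x; exists n => i ni /=.
  by rewrite xn // linear0.
have gn x n : (forall i, (n <= i)%N -> phi i x = 0) ->
    g x = \sum_(i < n) tens (b i : P) (phi i x).
  by move=> xn; apply: gE => i ni /=; rewrite xn // linear0.
apply: (cancel_isomorphic (f := ev) (g := g)) => x.
  have := @tens_generates R M P [set x | g (ev x) = x]; apply.
    split=> [|a u v gu gv]; first by rewrite /= !linear0.
    by rewrite /= !linearP gu gv.
  move=> p m /=; rewrite evE; have [n pn] := hom_coord_bound p.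
  rewrite (gn _ n) => [|i ni]; last exact: pn.
  rewrite [in RHS](element_basisE (x := p) (n := n) hom_element_basis); last first.
    by move=> i ni; apply: endoP => y; apply: pn.
  rewrite tens_suml; apply: eq_bigr => i _.
  by rewrite (tensS _ (hom_coord i p : S)).
have [n [xn xE]] := bphi x; rewrite (gn x n xn) linear_sum [RHS]xE.
by apply: eq_bigr => i _; rewrite evE.
Qed.

End HomTensor.

(** * The decomposition of the monoid *)
Section FinalInclusions.
Variables (R : comPzRingType) (M : lmodType R).
Hypothesis M_fin_gen : fin_gen M.

Lemma V_fin_V_star c : V_fin M c -> V_star M c.
Proof.
move=> [N [cN [n Nn]]]; exists N; split=> //; last by exists 'I_n.
apply: hom_image_count_gen (summand_hom_image Nn) _.
exact/dsum_count_gen/fin_gen_count_gen.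
Qed.

Lemma B_big_V_star c : B_big M c -> V_star M c.
Proof.
move=> [N [cN [I [_ _ [P' [_ _ [P [[cP pP _] _] PN]]]]]]].
have [b [phi bphi]] := projective_element_basis cP pP.
have [d [psi [dpsi _]]] := tensor_dual_basis bphi.
have sN := isomorphic_summand PN (dual_basis_summand dpsi).
exists N; split=> //; last by exists nat.
apply: hom_image_count_gen (summand_hom_image sN) _.
exact/dsum_count_gen/fin_gen_count_gen.
Qed.

(** The functionals psi_i on the finitely generated module P (x)_S M vanish for
i large, hence so do the phi_i, and finitely many b_i generate P. *)
Lemma V_fin_not_B_big c : V_fin M c -> ~ B_big M c.
Proof.
move=> [N1 [cN1 [n N1n]]] [N2 [cN2 [I [trI I0 [P' [_ _ [P [bigP _] PN2]]]]]]].
have N21 : isomorphic N2 N1.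
  by have := isomorphic_refl N1; rewrite -/(iso_class N1 N1) -cN1 cN2.
have [cP pP _] := bigP.
have [b [phi bphi]] := projective_element_basis cP pP.
have [d [psi [dpsi psiE]]] := tensor_dual_basis bphi.
have fT : fin_gen (tensor P).
  apply: hom_image_fin_gen (isomorphic_hom_image (isomorphic_sym PN2)) _.
  apply: hom_image_fin_gen (isomorphic_hom_image (isomorphic_sym N21)) _.
  by apply: hom_image_fin_gen (summand_hom_image N1n) _; apply: dsum_fin_gen.
have [|k kP] := fin_gen_locally_finite fT (phi := psi).
  by move=> x; have [m [xm _]] := dpsi x; exists m.
apply: (big_not_fin_gen trI I0 bigP).
exists k, (fun i => b i) => p; exists (fun i => phi i p : (endo M)^c).
apply: (element_basisE bphi) => i ki; apply: endoP => m.
by rewrite -psiE kP.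
Qed.

End FinalInclusions.

(** If I = 0, then phi_i vanishes on the images of all b_j for i >= n, hence
vanishes, and N is a summand of a sum of n copies of M. *)
Lemma V_star_V_fin_or_B_big (R : comPzRingType) (M : lmodType R)
    (c : module_class R) :
  noetherian R -> fin_gen M -> V_star M c -> V_fin M c \/ B_big M c.
Proof.
move=> noethR fM [N [cN gN [X NX]]].
have [b [phi bphi]] := summand_dual_basis gN NX.
have basis := hom_element_basis fM bphi.
have [n [I [phiI trI bigI fI pI]]] :=
  projective_big (endo_centrally_noetherian noethR fM) basis.
have [I0|I0] := pselect ([set x | x \in I] = [set 0]); last first.
  right; exists N; split=> //; exists I; split=> //.
  exists (reduction (hom_module M N) I); split=> //; exists (hom_module M N).
    by split=> //; apply: isomorphic_refl.
  exact: tensor_hom_isomorphic bphi.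
left; exists N; split=> //; exists n.
have phi0 i x : (n <= i)%N -> phi i x = 0.
  move=> ni; have [k [_ ->]] := bphi x; rewrite linear_sum big1 // => j _.
  have : [set x | x \in I] (hom_coord phi i (b j : hom_module M N) : endo M).
    exact: phiI.
  by rewrite I0 => /(congr1 (fun f : endo M => f (phi j x))).
have fin_in x : (fun a : 'I_n => phi a x) \in @finsupp R 'I_n M.
  by apply/asboolP; apply: finite_finset.
have li : linear (fun x => DSum (fin_in x)).
  by move=> a x y; apply: dsumP => i /=; rewrite linearP.
have lp : linear (fun u : dsum 'I_n M => \sum_(i < n) b i (u i)).
  move=> a u v; rewrite scaler_sumr -big_split; apply: eq_bigr => i _.
  exact: (linearP (b i)).
apply: (retract_summand (i := mk_linear li) (p := mk_linear lp)) => x.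
by rewrite [RHS](dual_basisE bphi (fun i ni => phi0 i x ni)).
Qed.

Theorem corollary3p14 (R : comPzRingType) (M : lmodType R)
  (R_noetherian : noetherian R) (M_fin_gen : fin_gen M) (c : module_class R) :
  ~ (V_fin M c /\ B_big M c) /\ (V_fin M c \/ B_big M c <-> V_star M c).
Proof.
split; first by move=> [/(V_fin_not_B_big M_fin_gen)].
split; last exact: V_star_V_fin_or_B_big.
by case; [apply: V_fin_V_star|apply: B_big_V_star].
Qed.
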